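(* Let $T\subset\mathbb R^2$ be a nondegenerate triangle and $k\ge2$ an integer. A function $v\in U_{k+2}(T)=\mathbb P_{k+2}(T)\oplus\operatorname{span}\{v_0,v_1,v_2\}$ is uniquely determined by the following degrees of freedom: $$v(\mathtt v),\qquad\mathtt v\in\Delta_0(T),$$ $$\nabla v(\mathtt v),\qquad\mathtt v\in\Delta_0(T),$$ $$\int_e v\,q\,{\rm d}s,\qquad q\in\mathbb P_{k-2}(e),\ e\in\Delta_1(T),$$ $$\int_e\frac{\partial v}{\partial n}\,q\,{\rm d}s,\qquad q\in\mathbb P_{k-1}(e),\ e\in\Delta_1(T),$$ $$\int_T v\,q\,{\rm d}x,\qquad q\in\mathbb P_{k-4}(T).$$ That is, these degrees of freedom (with $q$ running through bases) are unisolvent for $U_{k+2}(T)$.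
   Context: $T$ has vertices $\mathtt v_0,\mathtt v_1,\mathtt v_2$, area $|T|$ and barycenter $\mathtt v_c=(\mathtt v_0+\mathtt v_1+\mathtt v_2)/3$. The barycentric refinement splits $T$ into subtriangles $T_0,T_1,T_2$, where $T_i$ is the convex hull of $\mathtt v_c$ and the two vertices $\mathtt v_j$, $j\ne i$. $\lambda_i$ is the barycentric coordinate of $T$ associated with $\mathtt v_i$; $\lambda_i^{\rm R}$ is the continuous function on $T$, affine on each $T_j$, with $\lambda_i^{\rm R}(\mathtt v_i)=1$ and value $0$ at $\mathtt v_c$ and at the other two vertices. The enrichment functions, which belong to $C^1(T)$, are $$v_i=\frac{4|T|^2}{9(k+1)}(\lambda_i^{\rm R})^{k+1}(\lambda_{i-1}-\lambda_{i+1}),\qquad i=0,1,2\ (\text{indices modulo }3).$$ $\Delta_0(T)$ and $\Delta_1(T)$ are the sets of vertices and edges of $T$; $\partial/\partial n$ is the derivative in the direction of a fixed unit normal to the edge; $\mathbb P_m$ denotes polynomials of degree at most $m$, with $\mathbb P_m=\{0\}$ for $m<0$. *)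

(* Defs.v *)
From HB Require Import structures.
From mathcomp Require Import all_boot all_order all_algebra.
From mathcomp Require Import all_classical all_reals all_analysis.
From mathcomp Require Import ring lra.

Set Implicit Arguments.
Unset Strict Implicit.
Unset Printing Implicit Defensive.

Import Order.TTheory GRing.Theory Num.Theory.
Import numFieldNormedType.Exports.

Local Open Scope classical_set_scope.
Local Open Scope ring_scope.

(* The library norm of R * R is the sup norm, hence these Euclidean notions. *)
Definition dot (R : realType) (u w : R * R) : R := u.1 * w.1 + u.2 * w.2.

Definition enorm (R : realType) (u : R * R) : R := Num.sqrt (dot u u).

Definition det2 (R : realType) (u w : R * R) : R := u.1 * w.2 - u.2 * w.1.

Definition plane_measure (R : realType) :=
  (@lebesgue_measure R \x @lebesgue_measure R)%E.

(* A triangle is given by its vertices V : 'I_3 -> R * R.  The type 'I_3 is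
   the additive group of integers modulo 3, so i + 1 and i - 1 below are the
   cyclic neighbours of i. *)

Definition nondegenerate_triangle (R : realType) (V : 'I_3 -> R * R) : Prop :=
  det2 (V 1 - V 0) (V (-1) - V 0) != 0.

Definition hull (R : realType) (V : 'I_3 -> R * R) : set (R * R) :=
  [set x | exists t : 'I_3 -> R,
    [/\ forall i, 0 <= t i, \sum_i t i = 1 & x = \sum_i t i *: V i]].

Definition area (R : realType) (V : 'I_3 -> R * R) : R :=
  fine (@plane_measure R (hull V)).

Definition barycenter (R : realType) (V : 'I_3 -> R * R) : R * R :=
  3^-1 *: \sum_i V i.

Definition subtriangle (R : realType) (V : 'I_3 -> R * R) (i : 'I_3) :
    set (R * R) :=
  hull (fun j => if j == i then barycenter V else V j).

(* Ratio of signed areas; see bary_sum, bary_comb and bary_vertex. *)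
Definition bary (R : realType) (V : 'I_3 -> R * R) (i : 'I_3) (x : R * R) : R :=
  det2 (V (i + 1) - x) (V (i - 1) - x)
  / det2 (V (i + 1) - V i) (V (i - 1) - V i).

(* P_m(D): functions whose restriction to D is a polynomial of total degree at
   most m.  The coefficient of x1^i x2^j in p is p`_j`_i.  The degree bound is
   an integer, and for m < 0 the only such p is 0.  A function on D is
   represented by any function on the plane, up to equality on D. *)
Definition polyOn (R : realType) (m : int) (D : set (R * R)) (f : R * R -> R) :
    Prop :=
  exists p : {poly {poly R}},
    (forall i j : nat, p`_j`_i != 0 -> ((i + j)%N%:Z <= m)) /\
    (forall x, D x -> f x = p.[x.2%:P].[x.1]).

Definition is_basis (R : realType) (D : set (R * R)) (W : set (R * R -> R))
    (n : nat) (b : 'I_n -> R * R -> R) : Prop :=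
  (forall j, W (b j)) /\
  (forall f, W f ->
    exists! c : 'I_n -> R, forall x, D x -> f x = \sum_j c j * b j x).

Definition is_refined_hat (R : realType) (V : 'I_3 -> R * R) (i : 'I_3)
    (f : R * R -> R) : Prop :=
  [/\ {within hull V, continuous f},
      forall j, polyOn 1 (subtriangle V j) f,
      forall j, f (V j) = (j == i)%:R
    & f (barycenter V) = 0].

Definition enrichment (R : realType) (V : 'I_3 -> R * R) (k : nat)
    (lamR : 'I_3 -> R * R -> R) (i : 'I_3) (x : R * R) : R :=
  4 * area V ^+ 2 / (9 * k.+1%:R)
  * lamR i x ^+ k.+1 * (bary V (i - 1) x - bary V (i + 1) x).

Definition spanOn (R : realType) (D : set (R * R)) (n : nat)
    (g : 'I_n -> R * R -> R) : set (R * R -> R) :=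
  [set f | exists c : 'I_n -> R, forall x, D x -> f x = \sum_j c j * g j x].

Definition sumOn (R : realType) (D : set (R * R)) (A B : set (R * R -> R)) :
    set (R * R -> R) :=
  [set f | exists g h, [/\ A g, B h & forall x, D x -> f x = g x + h x]].

Definition directOn (R : realType) (D : set (R * R)) (A B : set (R * R -> R)) :
    Prop :=
  forall g h, A g -> B h -> (forall x, D x -> g x + h x = 0) ->
  forall x, D x -> g x = 0 /\ h x = 0.

Definition U_space (R : realType) (V : 'I_3 -> R * R) (k : nat)
    (lamR : 'I_3 -> R * R -> R) : set (R * R -> R) :=
  sumOn (hull V) (polyOn (k%:Z + 2) (hull V))
                 (spanOn (hull V) (enrichment V k lamR)).

(* Differentiability relative to D: at boundary points of a triangle this is
   the one-sided (C^1 up to the boundary) notion of gradient. *)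
Definition is_gradient (R : realType) (D : set (R * R)) (f : R * R -> R)
    (x g : R * R) : Prop :=
  forall e : R, 0 < e ->
    \forall y \near within D (nbhs x),
      `|f y - f x - dot g (y - x)| <= e * enorm (y - x).

Definition gradient (R : realType) (D : set (R * R)) (f : R * R -> R)
    (x : R * R) : R * R :=
  xget 0 [set g | is_gradient D f x g].

(* Edge i is the one opposite to vertex i. *)
Definition edge_vec (R : realType) (V : 'I_3 -> R * R) (i : 'I_3) : R * R :=
  V (i - 1) - V (i + 1).

Definition edge_point (R : realType) (V : 'I_3 -> R * R) (i : 'I_3) (t : R) :
    R * R :=
  V (i + 1) + t *: edge_vec V i.

Definition edge (R : realType) (V : 'I_3 -> R * R) (i : 'I_3) : set (R * R) :=
  edge_point V i @` `[0, 1].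

Definition edge_integral (R : realType) (V : 'I_3 -> R * R) (i : 'I_3)
    (f : R * R -> R) : R :=
  enorm (edge_vec V i)
  * \int[@lebesgue_measure R]_(t in `[0, 1]) f (edge_point V i t).

Definition is_unit_normal (R : realType) (V : 'I_3 -> R * R) (i : 'I_3)
    (n : R * R) : Prop :=
  enorm n = 1 /\ dot n (edge_vec V i) = 0.

Inductive dof_index (a b c : nat) : Type :=
| VertexValue of 'I_3
| VertexD1 of 'I_3
| VertexD2 of 'I_3
| EdgeMoment of 'I_3 & 'I_a
| EdgeNormalMoment of 'I_3 & 'I_b
| InteriorMoment of 'I_c.

Definition dof (R : realType) (V nrm : 'I_3 -> R * R) (a b c : nat)
    (qa : 'I_3 -> 'I_a -> R * R -> R) (qb : 'I_3 -> 'I_b -> R * R -> R)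
    (qc : 'I_c -> R * R -> R) (J : dof_index a b c) (v : R * R -> R) : R :=
  match J with
  | VertexValue i => v (V i)
  | VertexD1 i => (gradient (hull V) v (V i)).1
  | VertexD2 i => (gradient (hull V) v (V i)).2
  | EdgeMoment i j => edge_integral V i (fun x => v x * qa i j x)
  | EdgeNormalMoment i j =>
      edge_integral V i
        (fun x => dot (gradient (hull V) v x) (nrm i) * qb i j x)
  | InteriorMoment j => \int[@plane_measure R]_(x in hull V) (v x * qc j x)
  end.

Definition unisolvent (R : realType) (D : set (R * R)) (U : set (R * R -> R))
    (J : Type) (l : J -> (R * R -> R) -> R) : Prop :=
  forall d : J -> R,
    (exists v, U v /\ forall j, l j v = d j) /\
    (forall v w, U v -> U w ->
      (forall j, l j v = d j) -> (forall j, l j w = d j) ->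
      forall x, D x -> v x = w x).


Lemma ord3E (i : 'I_3) : [\/ i = 0, i = 1 | i = -1].
Proof.
by case: i => [[|[|[|//]]] ?]; [constructor 1 | constructor 2 | constructor 3];
  exact: val_inj.
Qed.

Lemma ord3_cyc :
  ((1 + 1 = -1 :> 'I_3) * (-1 + 1 = 0 :> 'I_3)) *
  ((1 - 1 = 0 :> 'I_3) * (-1 - 1 = 1 :> 'I_3)) *
  ((0 + 1 = 1 :> 'I_3) * (0 - 1 = -1 :> 'I_3)).
Proof. by do !split; exact: val_inj. Qed.

Lemma sum_ord3 (M : nmodType) (F : 'I_3 -> M) :
  \sum_i F i = F 0 + F 1 + F (-1).
Proof.
rewrite !big_ord_recl big_ord0 addr0 addrA.
by congr (F _ + F _ + F _); exact: val_inj.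
Qed.

Lemma nondegenerate_triangle_cyc (R : realType) (V : 'I_3 -> R * R) (i : 'I_3) :
  nondegenerate_triangle V -> det2 (V (i + 1) - V i) (V (i - 1) - V i) != 0.
Proof.
rewrite /nondegenerate_triangle /det2; have [] := ord3E i => ->; rewrite !ord3_cyc //=;
by apply: contra_neq => h; rewrite -[RHS]h; ring.
Qed.

Lemma bary_eq (R : realType) (V : 'I_3 -> R * R) (i : 'I_3) (x : R * R) :
  bary V i x = det2 (V (i + 1) - x) (V (i - 1) - x)
               / det2 (V 1 - V 0) (V (-1) - V 0).
Proof.
rewrite /bary; congr (_ / _); rewrite /det2.
by have [] := ord3E i => ->; rewrite !ord3_cyc //=; ring.
Qed.

Lemma bary_sum (R : realType) (V : 'I_3 -> R * R) (x : R * R) :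
  nondegenerate_triangle V -> \sum_i bary V i x = 1.
Proof.
move=> nd; rewrite sum_ord3 !bary_eq -!mulrDl !ord3_cyc.
by apply: (canLR (mulfK nd)); rewrite mul1r /det2 /=; ring.
Qed.

Lemma bary_comb (R : realType) (V : 'I_3 -> R * R) (x : R * R) :
  nondegenerate_triangle V -> \sum_i bary V i x *: V i = x.
Proof.
move=> nd; rewrite sum_ord3 !bary_eq !ord3_cyc; move: nd; rewrite /nondegenerate_triangle.
set D := det2 _ _ => nd; apply: (scalerI nd).
rewrite !scalerDr !scalerA !mulrA ![D * _]mulrC !mulfK // /D /det2.
by case: x => x1 x2; congr pair; rewrite /= /GRing.scale /=; ring.
Qed.

Lemma bary_vertex (R : realType) (V : 'I_3 -> R * R) (i j : 'I_3) :
  nondegenerate_triangle V -> bary V i (V j) = (j == i)%:R.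
Proof.
move=> nd; have [->|] := eqVneq j i; first by rewrite /bary divff ?nondegenerate_triangle_cyc.
move=> ji; rewrite /bary; have -> : det2 (V (i + 1) - V j) (V (i - 1) - V j) = 0.
  rewrite /det2; move: ji; have [] := ord3E i => ->; have [] := ord3E j => ->;
  by rewrite // !ord3_cyc //= => _; ring.
by rewrite mul0r.
Qed.

Lemma bary_affine (R : realType) (V : 'I_3 -> R * R) (i : 'I_3) :
  exists a b c : R, forall x, bary V i x = a * x.1 + b * x.2 + c.
Proof.
set D := det2 (V (i + 1) - V i) (V (i - 1) - V i).
exists (((V (i + 1)).2 - (V (i - 1)).2) / D).
exists (((V (i - 1)).1 - (V (i + 1)).1) / D).
exists (det2 (V (i + 1)) (V (i - 1)) / D) => y.
by rewrite /bary -/D /det2 /=; ring.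
Qed.

Lemma bary_comb_hull (R : realType) (V W : 'I_3 -> R * R) (i : 'I_3)
    (t : 'I_3 -> R) : \sum_j t j = 1 ->
  bary V i (\sum_j t j *: W j) = \sum_j t j * bary V i (W j).
Proof.
have [a [b [c h]]] := bary_affine V i.
by rewrite !sum_ord3 !h /= /GRing.scale /= => ht; rewrite -[c in LHS]mul1r -ht; ring.
Qed.

Lemma polyOn_affine (R : realType) (D : set (R * R)) (f : R * R -> R)
    (a b c : R) :
  (forall x, D x -> f x = a * x.1 + b * x.2 + c) -> polyOn 1 D f.
Proof.
move=> h; exists ((a *: 'X + c%:P)%:P + b%:P%:P * 'X); split; last first.
  by move=> x /h ->; rewrite !hornerE /=; ring.
move=> i [|[|j]]; rewrite coefD coefCM coefC coefX /= ?mulr0 ?mulr1 ?addr0 ?add0r.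
- by case: i => [|[|i]] //; rewrite coefD coefZ coefX coefC /= ?mulr0 ?addr0 ?eqxx.
- by case: i => [|i] //; rewrite coefC /= eqxx.
- by rewrite coef0 eqxx.
Qed.

Lemma refined_hat_exists (R : realType) (V : 'I_3 -> R * R) (i : 'I_3) :
  nondegenerate_triangle V -> exists f, is_refined_hat V i f.
Proof.
move=> nd.
pose m x := Num.min (bary V 0 x) (Num.min (bary V 1 x) (bary V (-1) x)).
have mE x j : (forall l, bary V j x <= bary V l x) -> m x = bary V j x.
  move=> h; rewrite /m; have [h0 h1 h2] := And3 (h 0) (h 1) (h (-1)).
  apply/eqP; rewrite eq_le; apply/andP; split; last by rewrite !le_min h0 h1 h2.
  by have [] := ord3E j => ->; rewrite !ge_min lexx ?orbT.
have bc l : bary V l (barycenter V) = 3^-1.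
  rewrite /barycenter scaler_sumr (bary_comb_hull V V l (t := fun=> 3^-1)).
    by rewrite sum_ord3 !bary_vertex //; have [] := ord3E l => -> /=; field.
  by rewrite sum_ord3; field.
have cb l : continuous (bary V l).
  have [a [b [c h]]] := bary_affine V l => x.
  have -> : bary V l = (fun x : R * R => a * x.1 + b * x.2 + c) by exact/funext.
  apply: cvgD; last exact: cvg_cst.
  by apply: cvgD; (apply: cvgM; first exact: cvg_cst); [exact: cvg_fst|exact: cvg_snd].
exists (fun x => bary V i x - m x); split.
- apply: continuous_subspaceT => x; apply: cvgB; first exact: cb.
  rewrite /m.
  by apply: (@continuous_min _ _ (bary V 0) _ x (cb 0 x));
     apply: (@continuous_min _ _ (bary V 1) _ x (cb 1 x)); exact: cb.
- move=> j; have [a [b [c h]]] := bary_affine V i.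
  have [a' [b' [c' h']]] := bary_affine V j.
  apply: (@polyOn_affine _ _ _ (a - a') (b - b') (c - c')) => x [t [t0 t1 xE]].
  rewrite (mE x j); first by rewrite h h'; ring.
  move=> l; rewrite xE !bary_comb_hull // !sum_ord3 -subr_ge0.
  have [t00 t01 t02] := And3 (t0 0) (t0 1) (t0 (-1)).
  by have [] := ord3E j => ->; have [] := ord3E l => -> /=;
     rewrite !bc ?bary_vertex //=; lra.
- move=> j; rewrite bary_vertex // (mE _ (j + 1)) ?bary_vertex //.
    by have [] := ord3E j => ->; rewrite ?ord3_cyc subr0.
  move=> l; rewrite !bary_vertex //.
  by have [] := ord3E j => ->; have [] := ord3E l => ->; rewrite ?ord3_cyc.
- by rewrite (mE _ 0) ?bc ?subrr // => l; rewrite !bc.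
Qed.

(* Main.v *)
Require Import Defs.
From HB Require Import structures.
From mathcomp Require Import all_boot all_order all_algebra.
From mathcomp Require Import all_classical all_reals all_analysis.
From mathcomp Require Import measurable_realfun.
From mathcomp Require Import zify ring lra.

Set Implicit Arguments.
Unset Strict Implicit.
Unset Printing Implicit Defensive.

Import Order.TTheory GRing.Theory Num.Theory.
Import numFieldNormedType.Exports.

Local Open Scope classical_set_scope.
Local Open Scope ring_scope.

(** Uniqueness carries the theorem; existence then follows from counting.

    Let v = p + sum_i c_i v_i have vanishing degrees of freedom.  On the
    subtriangle T_i, which contains the edge e_i opposite to vertex i, v equals
    the polynomial
      P_i = p + C sum_j c_j (l_j - l_i)^(k+1) (l_(j-1) - l_(j+1)),
    where l_j = bary V j, because the refined hat of vertex j is l_j - l_i on T_i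
    ([refined_hatE]).  So on e_i the function v and its normal derivative are
    univariate polynomials of degree at most k+2 and k+1.  Values and gradients at
    the two endpoints make the first one t^2 (1-t)^2 r and the second one
    t (1-t) r; testing with r itself shows that both vanish
    ([moment_free_hermite], [moment_free_lagrange]).  Hence P_i vanishes to second
    order on the line of e_i, that is, P_i = l_i^2 A_i ([polyfun_div_bary2]).

    The enrichment cannot survive this.  Near vertex l, with coordinates
    x = l_(l+1) and y = l_(l-1), the difference P_(l+1) - P_(l-1) contains p no
    longer; by its definition it equals (x-y)^2 times a function whose value at the
    vertex is a nonzero multiple of c_l, whereas it also equals x^2 A - y^2 B.  The
    quadratic part a x^2 - b y^2 of the latter has no term xy, so c_l = 0
    ([enrichment_coef_eq0]).

    What remains is p = l_i^2 A_i for all i, whence p = l_0^2 l_1^2 l_2^2 r with r of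
    degree at most k-4, and the interior moment of p against r is the integral of
    a square ([dof_eq0_interior]).  So r = 0 and p = 0.

    For existence, the monomials of degree at most k+2 and the three enrichment
    functions give a parametrization of U on which the degrees of freedom act
    linearly ([dof_comb]) and injectively; there are at least as many parameters as
    degrees of freedom ([dimension_count]), and an injective linear map into a space
    of no larger dimension is onto ([injective_card]).  The same injectivity shows
    that the sum defining U is direct. *)

(** * Polynomial functions on the plane *)

Section PlanePolynomials.
Variable R : realType.
Implicit Types (n m : nat) (f g h l : R * R -> R).

(** [n] is an exclusive bound on the degree, so that [polyfun 0] holds only of the
    zero function.  The recursion on the degree lets one prove closure properties,
    differentiability and division by induction, without handling coefficients. *)
Fixpoint polyfun n f : Prop :=
  if n is m.+1 then exists c g h,
    [/\ polyfun m g, polyfun m h & forall x, f x = c + x.1 * g x + x.2 * h x]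
  else forall x, f x = 0.

Lemma eq_polyfun n f g : (forall x, f x = g x) -> polyfun n g -> polyfun n f.
Proof. by move=> /funext ->. Qed.

Lemma polyfun0 n : polyfun n (fun=> 0).
Proof.
elim: n => //= n ih; exists 0, (fun=> 0), (fun=> 0); split=> // x; ring.
Qed.

Lemma polyfun_cst n c : polyfun n.+1 (fun=> c).
Proof. by exists c, (fun=> 0), (fun=> 0); split=> [||x]; [exact: polyfun0..|ring]. Qed.

Lemma polyfunS n f : polyfun n f -> polyfun n.+1 f.
Proof.
elim: n f => [f f0|n ih f [c [g [h [pg ph fE]]]]].
  by apply: (@eq_polyfun _ _ (fun=> 0)) => //; exact: polyfun0.
by exists c, g, h; split => //; exact: ih.
Qed.

Lemma polyfun_le n m f : (n <= m)%N -> polyfun n f -> polyfun m f.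
Proof. by move/subnK <-; elim: (m - n)%N => // j ih /ih; exact: polyfunS. Qed.

Lemma polyfunD n f g : polyfun n f -> polyfun n g -> polyfun n (fun x => f x + g x).
Proof.
elim: n f g => [f g f0 g0 x|n ih f g]; first by rewrite f0 g0 addr0.
move=> [c [f1 [f2 [p1 p2 fE]]]] [d [g1 [g2 [q1 q2 gE]]]].
exists (c + d), (fun x => f1 x + g1 x), (fun x => f2 x + g2 x).
by split=> [||x]; [exact: ih..|rewrite fE gE; ring].
Qed.

Lemma polyfunZ n a f : polyfun n f -> polyfun n (fun x => a * f x).
Proof.
elim: n f => [f f0 x|n ih f]; first by rewrite f0 mulr0.
move=> [c [f1 [f2 [p1 p2 fE]]]].
exists (a * c), (fun x => a * f1 x), (fun x => a * f2 x).
by split=> [||x]; [exact: ih..|rewrite fE; ring].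
Qed.

Lemma polyfunB n f g : polyfun n f -> polyfun n g -> polyfun n (fun x => f x - g x).
Proof.
move=> pf /(polyfunZ (-1)) pg; apply: (eq_polyfun _ (polyfunD pf pg)) => x; ring.
Qed.

Lemma polyfun_sum n (I : Type) (s : seq I) (P : pred I) (F : I -> R * R -> R) :
  (forall i, P i -> polyfun n (F i)) -> polyfun n (fun x => \sum_(i <- s | P i) F i x).
Proof.
move=> pF; elim: s => [|i s ih].
  by apply: eq_polyfun (polyfun0 n) => x; rewrite big_nil.
case Pi: (P i); last by apply: eq_polyfun ih => x; rewrite big_cons Pi.
by apply: eq_polyfun (polyfunD (pF i Pi) ih) => x; rewrite big_cons Pi.
Qed.

Definition affine l := exists a b c : R, forall x, l x = a * x.1 + b * x.2 + c.

Lemma affine_polyfun l : affine l -> polyfun 2 l.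
Proof.
move=> [a [b [c lE]]]; exists c, (fun=> a), (fun=> b).
by split=> [||x]; [exact: polyfun_cst..|rewrite lE; ring].
Qed.

(** Substitutions, products with hats and powers of barycentric coordinates are all
    built from this one multiplication. *)
Lemma polyfunM_affine n f l : affine l -> polyfun n f -> polyfun n.+1 (fun x => l x * f x).
Proof.
move=> al; elim: n f => [f f0|n ih f [c [g [h [pg ph fE]]]]].
  by apply: eq_polyfun (polyfun0 1) => x; rewrite f0 mulr0.
have p1 : polyfun n.+2 (fun x => c * l x).
  exact: polyfunZ (polyfun_le _ (affine_polyfun al)).
have p2 : polyfun n.+2 (fun x => x.1 * (l x * g x) + x.2 * (l x * h x)).
  exists 0, (fun x => l x * g x), (fun x => l x * h x).
  by split=> [||x]; [exact: ih..|ring].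
by apply: (eq_polyfun _ (polyfunD p1 p2)) => x; rewrite fE; ring.
Qed.

Lemma polyfunM_affineX n f l j :
  affine l -> polyfun n f -> polyfun (j + n) (fun x => l x ^+ j * f x).
Proof.
move=> al pf; elim: j => [|j ih]; first by apply: eq_polyfun pf => x; rewrite mul1r.
by apply: (eq_polyfun _ (polyfunM_affine al ih)) => x; rewrite exprS mulrA.
Qed.

Lemma polyfun_comp n f l1 l2 :
  affine l1 -> affine l2 -> polyfun n f -> polyfun n (fun x => f (l1 x, l2 x)).
Proof.
move=> a1 a2; elim: n f => [f f0 x //|n ih f [c [g [h [pg ph fE]]]]].
apply: eq_polyfun (polyfunD (polyfun_cst n c)
  (polyfunD (polyfunM_affine a1 (ih _ pg)) (polyfunM_affine a2 (ih _ ph)))) => x.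
by rewrite fE /=; ring.
Qed.

Lemma differentiable_polyfun n f x : polyfun n f -> differentiable f x.
Proof.
elim: n f => [f /funext ->|n ih f [c [g [h [pg ph /funext ->]]]]].
  exact: (differentiable_cst 0).
have d1 : differentiable (fst : R * R -> R) x.
  apply: (@linear_differentiable R (R * R)%type R (@fst R^o R^o)) => y; exact: cvg_fst.
have d2 : differentiable (snd : R * R -> R) x.
  apply: (@linear_differentiable R (R * R)%type R (@snd R^o R^o)) => y; exact: cvg_snd.
by apply: (differentiableD (differentiableD (differentiable_cst c x)
  (differentiableM d1 (ih _ pg))) (differentiableM d2 (ih _ ph))).
Qed.

(** Restriction to a line is how every statement about plane polynomials is reduced
    to univariate ones. *)
Lemma polyfun_line n f a d : polyfun n f ->
  exists2 w : {poly R}, (size w <= n)%N & forall t, f (a + t *: d) = w.[t].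
Proof.
elim: n f => [f f0|n ih f [c [g [h [/ih [u su gE] /ih [v sv hE] fE]]]]].
  by exists 0 => [|t]; rewrite ?size_poly0 ?horner0.
have sM (e1 e2 : R) (w : {poly R}) : (size w <= n)%N ->
    (size ((e1 *: 'X + e2%:P) * w)%R <= n.+1)%N.
  move=> sw; apply: leq_trans (size_polyMleq _ _) _.
  have : (size (e1 *: 'X + e2%:P)%R <= 2)%N.
    apply: leq_trans (size_polyD _ _) _; rewrite geq_max.
    rewrite (leq_trans (size_scale_leq _ _)) ?size_polyX //.
    by rewrite (leq_trans (size_polyC_leq1 _)).
  by move=> sp; rewrite -subn1 leq_subLR add1n -[n.+2]/(2 + n)%N leq_add.
exists (c%:P + (d.1 *: 'X + a.1%:P) * u + (d.2 *: 'X + a.2%:P) * v) => [|t].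
  rewrite (leq_trans (size_polyD _ _)) // geq_max sM // andbT.
  rewrite (leq_trans (size_polyD _ _)) // geq_max sM // andbT.
  by rewrite (leq_trans (size_polyC_leq1 _)).
by rewrite fE gE hE !hornerE /= /GRing.scale /=; ring.
Qed.

Lemma polyfun_continuous n f : polyfun n f -> continuous f.
Proof.
by move=> pf x; apply: differentiable_continuous; exact: differentiable_polyfun pf.
Qed.

Lemma polyfun_measurable n f : polyfun n f -> measurable_fun [set: R * R] f.
Proof.
elim: n f => [f /funext ->|n ih f [c [g [h [pg ph /funext ->]]]]].
  exact: measurable_cst.
apply: measurable_funD; first apply: measurable_funD; first exact: measurable_cst.
- by apply: measurable_funM; [exact: measurable_fst|exact: ih].
- by apply: measurable_funM; [exact: measurable_snd|exact: ih].
Qed.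

(** The points e/2, e/3, and so on are more roots than the degree allows. *)
Lemma poly_eq0_near (w : {poly R}) (e : R) :
  0 < e -> (forall t, 0 <= t < e -> w.[t] = 0) -> w = 0.
Proof.
move=> e0 w0.
pose r (j : nat) := e / j.+2%:R.
apply: (@roots_geq_poly_eq0 _ _ (map r (iota 0 (size w)))).
- apply/allP => _ /mapP[j _ ->]; apply/rootP/w0; rewrite divr_ge0 ?(ltW e0) //=.
  by rewrite ltr_pdivrMr // ltr_pMr // ltr1n.
- rewrite map_inj_uniq ?iota_uniq // => i j.
  by move=> /(mulfI (lt0r_neq0 e0)) /invr_inj /eqP; rewrite eqr_nat => /eqP[].
- by rewrite size_map size_iota.
Qed.

Lemma cont_eq0 (f : R -> R) :
  {for 0, continuous f} -> (forall t, t != 0 -> f t = 0) -> f 0 = 0.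
Proof.
move=> cf f0.
have c1 : f t @[t --> 0^'] --> f 0 by apply: cvg_within_filter.
have c2 : f t @[t --> 0^'] --> (0 : R).
  apply: (@cvg_trans _ ((fun=> 0 : R) @ 0^')); last exact: cvg_cst.
  apply: near_eq_cvg; near=> t; rewrite f0 //; near: t; exact: nbhs_dnbhs_neq.
exact: (cvg_unique _ c1 c2).
Unshelve. all: by end_near. Qed.
End PlanePolynomials.

(** * Division by a coordinate *)

Section Division.
Variable R : realType.
Implicit Types (n m : nat) (f g h l : R * R -> R).

(** Write f = c + x1 g + x2 h.  Setting x2 = 0 gives c + x1 g(x1, 0) = 0, so c = 0 and
    g also vanishes on the axis, where the induction hypothesis applies to it. *)
Lemma polyfun_div_axis n f : polyfun n f -> (forall t, f (t, 0) = 0) ->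
  exists2 g, polyfun n.-1 g & forall x, f x = x.2 * g x.
Proof.
elim: n f => [f f0 _|n ih f [c [g [h [pg ph fE]]]] fz].
  by exists (fun=> 0) => // x; rewrite f0 mulr0.
have c0 : c = 0 by have := fz 0; rewrite fE /= !mul0r !addr0.
case: n => [|n] in ih pg ph *.
  by exists (fun=> 0) => // x; rewrite fE c0 pg ph !mulr0 !addr0.
have {}pg : polyfun n.+1 g := pg; have {}ph : polyfun n.+1 h := ph.
have gz t : g (t, 0) = 0.
  have gz' s : s != 0 -> g (s, 0) = 0.
    move=> s0; have := fz s; rewrite fE c0 /= mul0r addr0 add0r => /eqP.
    by rewrite mulf_eq0 (negPf s0) => /eqP.
  have [->|] := eqVneq t 0; last exact: gz'.
  apply: (@cont_eq0 R (fun s => g (s, 0))) => //.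
  have [w _ wE] := polyfun_line (0, 0) (1, 0) pg.
  have -> : (fun s => g (s, 0)) = horner w.
    apply/funext => s; rewrite -wE; congr (g _).
    by congr pair; rewrite /= /GRing.scale /=; ring.
  exact: continuous_horner.
have [g' pg' gE] := ih _ pg gz.
exists (fun x => x.1 * g' x + h x) => [|x]; last by rewrite fE gE c0; ring.
apply: polyfunD ph; exists 0, g', (fun=> 0).
by split=> [||x]; [|exact: polyfun0|ring].
Qed.
End Division.

(** * Barycentric coordinates, edges and divisibility *)

Section Geometry.
Variables (R : realType) (V : 'I_3 -> R * R).
Hypothesis hV : nondegenerate_triangle V.
Implicit Types (i j l : 'I_3) (x : R * R).

Lemma bary_is_affine i : affine (bary V i).
Proof. exact: bary_affine. Qed.

Lemma ord3_shift i :
  (i + 1 + 1 = i - 1 :> 'I_3) * (i + 1 - 1 = i :> 'I_3) *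
  (i - 1 + 1 = i :> 'I_3) * (i - 1 - 1 = i + 1 :> 'I_3).
Proof. by have [] := ord3E i => ->; rewrite !ord3_cyc. Qed.

Lemma ord3_cases i j : [\/ j = i, j = i + 1 | j = i - 1].
Proof.
by have [] := ord3E i => ->; have [] := ord3E j => ->; rewrite ?ord3_cyc;
  first [exact: Or31 | exact: Or32 | exact: Or33].
Qed.

Lemma ord3_neq i : ((i + 1 == i) = false) * ((i - 1 == i) = false) *
  ((i == i + 1) = false) * ((i == i - 1) = false) *
  ((i + 1 == i - 1) = false) * ((i - 1 == i + 1) = false).
Proof. by have [] := ord3E i => ->. Qed.

Lemma sum_cyc (M : nmodType) (F : 'I_3 -> M) i :
  \sum_j F j = F i + F (i + 1) + F (i - 1).
Proof.
rewrite sum_ord3; have [] := ord3E i => ->; rewrite !ord3_cyc //.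
- by rewrite -addrA addrC.
- by rewrite addrC addrA.
Qed.

Lemma bary_sum_cyc i x : bary V i x + bary V (i + 1) x + bary V (i - 1) x = 1.
Proof. by rewrite -(bary_sum x hV) (sum_cyc _ i). Qed.

Lemma bary_line i a d t :
  bary V i (a + t *: d) = bary V i a + t * (bary V i (a + d) - bary V i a).
Proof.
by have [p [q [r h]]] := bary_affine V i; rewrite !h /= /GRing.scale /=; ring.
Qed.

Lemma hullP x : hull V x <-> forall i, 0 <= bary V i x.
Proof.
split=> [[t [t0 t1 ->]] i|x0]; last first.
  by exists (bary V ^~ x); split=> //; rewrite ?bary_sum ?bary_comb.
rewrite bary_comb_hull // sumr_ge0 // => j _.
by rewrite bary_vertex // mulr_ge0 // ler0n.
Qed.

(** Affine coordinates adapted to edge [i]: the first one runs along the edge, the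
    second one is the barycentric coordinate that vanishes on it. *)
Definition chart i (y : R * R) : R * R :=
  edge_point V i y.1 + y.2 *: (V i - V (i + 1)).

Lemma bary_chart i y :
  [/\ bary V i (chart i y) = y.2, bary V (i - 1) (chart i y) = y.1
    & bary V (i + 1) (chart i y) = 1 - y.1 - y.2].
Proof.
have E : chart i y =
    \sum_j (if j == i then y.2 else if j == i - 1 then y.1 else 1 - y.1 - y.2) *: V j.
  rewrite (sum_cyc _ i) !ord3_neq !eqxx /chart /edge_point /edge_vec.
  case: (V i) (V (i + 1)) (V (i - 1)) => [a1 a2] [b1 b2] [c1 c2].
  by congr pair; rewrite /= /GRing.scale /=; ring.
have S : \sum_j (if j == i then y.2 else if j == i - 1 then y.1 else 1 - y.1 - y.2) = 1.
  by rewrite (sum_cyc _ i) !ord3_neq !eqxx; ring.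
split; rewrite E (bary_comb_hull _ _ _ S) (sum_cyc _ i) !bary_vertex //
  !ord3_neq !eqxx /=; ring.
Qed.

Lemma chartK i x : chart i (bary V (i - 1) x, bary V i x) = x.
Proof.
rewrite -[RHS](bary_comb x hV) (sum_cyc _ i) /chart /edge_point /edge_vec /=.
have -> : bary V (i + 1) x = 1 - bary V i x - bary V (i - 1) x.
  by rewrite -(bary_sum_cyc i x); ring.
move: (bary V i x) (bary V (i - 1) x) => s t.
case: (V i) (V (i + 1)) (V (i - 1)) => [a1 a2] [b1 b2] [c1 c2].
by congr pair; rewrite /= /GRing.scale /=; ring.
Qed.

Lemma chart0 i t : chart i (t, 0) = edge_point V i t.
Proof. by rewrite /chart scale0r addr0. Qed.

Lemma bary_edge i t :
  [/\ bary V i (edge_point V i t) = 0, bary V (i - 1) (edge_point V i t) = t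
    & bary V (i + 1) (edge_point V i t) = 1 - t].
Proof. by rewrite -chart0; have [-> -> ->] := bary_chart i (t, 0); rewrite subr0. Qed.

Lemma edge_hull i t : 0 <= t <= 1 -> hull V (edge_point V i t).
Proof.
move=> /andP[t0 t1]; apply/hullP => j; have [h1 h2 h3] := bary_edge i t.
by have [] := ord3_cases i j => ->; rewrite ?h1 ?h2 ?h3 ?subr_ge0.
Qed.

Lemma edge_point0 i : edge_point V i 0 = V (i + 1).
Proof. by rewrite /edge_point scale0r addr0. Qed.

Lemma edge_point1 i : edge_point V i 1 = V (i - 1).
Proof. by rewrite /edge_point scale1r addrC subrK. Qed.

Lemma vertex_hull i : hull V (V i).
Proof. by apply/hullP => j; rewrite bary_vertex // ler0n. Qed.

Lemma affine_chart i : affine (fun y => (chart i y).1) /\ affine (fun y => (chart i y).2).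
Proof.
rewrite /chart /edge_point; split.
- by exists (edge_vec V i).1, (V i - V (i + 1)).1, (V (i + 1)).1 => y /=;
    rewrite /GRing.scale /=; ring.
- by exists (edge_vec V i).2, (V i - V (i + 1)).2, (V (i + 1)).2 => y /=;
    rewrite /GRing.scale /=; ring.
Qed.

Lemma polyfun_chart i n f : polyfun n f -> polyfun n (fun y => f (chart i y)).
Proof.
move=> pf; have [a1 a2] := affine_chart i.
by apply: eq_polyfun (polyfun_comp a1 a2 pf) => y; rewrite -surjective_pairing.
Qed.

Lemma polyfun_div_bary i n f : polyfun n f -> (forall t, f (edge_point V i t) = 0) ->
  exists2 g, polyfun n.-1 g & forall x, f x = bary V i x * g x.
Proof.
move=> pf fz; have [t|g pg gE] := polyfun_div_axis (polyfun_chart i pf).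
  by rewrite chart0.
exists (fun x => g (bary V (i - 1) x, bary V i x)) => [|x].
  exact: (polyfun_comp (bary_is_affine _) (bary_is_affine _) pg).
by rewrite -[in LHS](chartK i x) gE.
Qed.

(** On the line where l_j = 0 the product l_i f vanishes while l_i is a nonzero
    univariate polynomial; so f vanishes there and is divisible by l_j. *)
Lemma polyfun_div_coprime i j n f g : i != j -> polyfun n f ->
  (forall x, bary V i x * f x = bary V j x * g x) ->
  exists2 h, polyfun n.-1 h & forall x, f x = bary V j x * h x.
Proof.
move=> ij pf fg; apply: polyfun_div_bary => // t.
have [w _ wE] : exists2 w : {poly R}, (size w <= n)%N &
    forall t, f (edge_point V j t) = w.[t] by exact: polyfun_line.
have [u _ uE] : exists2 u : {poly R}, (size u <= 2)%N &
    forall t, bary V i (edge_point V j t) = u.[t].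
  exact: polyfun_line (affine_polyfun (bary_is_affine i)).
have u0 : u != 0.
  apply/eqP => u0; move: (uE 0) (uE 1); rewrite u0 !horner0 edge_point0 edge_point1.
  by rewrite !bary_vertex //; have [e|->|->] := ord3_cases j i;
    [rewrite e eqxx in ij|rewrite eqxx /=; lra|rewrite eqxx /=; lra].
have /eqP : u * w = 0.
  apply: (@poly_eq0_near _ _ 1) => // s _; rewrite hornerM -uE -wE fg.
  by have [-> _ _] := bary_edge j s; rewrite mul0r.
by rewrite mulf_eq0 (negPf u0) wE => /eqP ->; rewrite horner0.
Qed.

Lemma barycenter_bary i : bary V i (barycenter V) = 3^-1.
Proof.
rewrite /barycenter scaler_sumr (bary_comb_hull V V i (t := fun=> 3^-1)).
  by rewrite sum_ord3 !bary_vertex //; have [] := ord3E i => -> /=; field.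
by rewrite sum_ord3; field.
Qed.

(** The line from the barycenter to any point starts with a segment of interior
    points. *)
Lemma polyfun_eq0_interior n f : polyfun n f ->
  (forall x, (forall i, 0 < bary V i x) -> f x = 0) -> forall x, f x = 0.
Proof.
move=> pf f0 x; pose b := barycenter V.
have [w _ wE] := polyfun_line b (x - b) pf.
suff w0 : w = 0 by move: (wE 1); rewrite w0 horner0 scale1r addrC subrK.
(* 3^-1 / M is so small that moving that far from the barycenter, where all
   coordinates are 3^-1, keeps them positive. *)
pose M := 1 + \sum_i `|bary V i x - 3^-1|.
have M0 : 0 < M by rewrite ltr_pwDl // sumr_ge0.
apply: (@poly_eq0_near _ _ (3^-1 / M)); first by rewrite divr_gt0 // invr_gt0.
move=> t /andP[t0 tM]; rewrite -wE; apply: f0 => i.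
rewrite bary_line [b + _]addrC subrK barycenter_bary -ltrBlDl sub0r.
have h : `|t * (bary V i x - 3^-1)| < 3^-1.
  rewrite normrM (ger0_norm t0); apply: le_lt_trans (_ : t * M < _).
    apply: ler_wpM2l => //; rewrite /M (bigD1 i) //= addrCA lerDl.
    by rewrite addr_ge0 // sumr_ge0.
  by rewrite -ltr_pdivlMr.
by move: h; rewrite ltr_norml => /andP[].
Qed.
End Geometry.

(** * Gradients relative to a set *)

Section Gradients.
Variable R : realType.
Implicit Types (f g : R * R -> R) (x y d u : R * R) (D : set (R * R)).

Lemma dotDl u x d : dot (u + x) d = dot u d + dot x d.
Proof. by rewrite /dot /=; ring. Qed.

Lemma dotZl (a : R) u d : dot (a *: u) d = a * dot u d.
Proof. by rewrite /dot /= /GRing.scale /=; ring. Qed.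

Lemma dotZr (a : R) u d : dot u (a *: d) = a * dot u d.
Proof. by rewrite /dot /= /GRing.scale /=; ring. Qed.

Lemma dotBl u x d : dot (u - x) d = dot u d - dot x d.
Proof. by rewrite /dot /=; ring. Qed.

(** The library norm on the plane is the sup norm; the relative gradient of the
    theorem uses the Euclidean one. *)
Lemma norm_le_enorm u : `|u| <= enorm u.
Proof.
rewrite prod_normE /= ge_max /enorm /dot -!expr2 -!sqrtr_sqr.
by rewrite !ler_sqrt ?addr_ge0 ?sqr_ge0 // lerDl lerDr !sqr_ge0.
Qed.

Lemma enormZ (a : R) u : 0 <= a -> enorm (a *: u) = a * enorm u.
Proof.
move=> a0; rewrite /enorm dotZl dotZr mulrA sqrtrM ?mulr_ge0 //.
by rewrite -expr2 sqrtr_sqr ger0_norm.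
Qed.

Lemma enorm_gt0 u : u != 0 -> 0 < enorm u.
Proof. by move=> u0; apply: lt_le_trans (norm_le_enorm u); rewrite normr_gt0. Qed.

Definition gradf f x : R * R := ('D_(1, 0) f x, 'D_(0, 1) f x).

Lemma dot_gradf f x d : differentiable f x -> dot (gradf f x) d = 'D_d f x.
Proof.
move=> df; rewrite /gradf !deriveE // /dot /=.
rewrite [_ * d.1]mulrC [_ * d.2]mulrC.
rewrite -[d.1 * _]/(d.1 *: ('d f x (1, 0))) -[d.2 * _]/(d.2 *: ('d f x (0, 1))).
rewrite -!linearZ -linearD; congr ('d f x _).
by case: d => d1 d2; congr pair; rewrite /= /GRing.scale /=; ring.
Qed.

Lemma is_gradient_gradf D f x : differentiable f x -> is_gradient D f x (gradf f x).
Proof.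
move=> df e e0; apply: cvg_within.
have /diff_locallyP[_] := df.
move=> /eqaddoP /(_ e e0) h.
have {}h : \forall y \near x, `|f y - f x - 'd f x (y - x)| <= e * `|y - x|.
  apply/(nbhs0P (fun y => `|f y - f x - ('d f x (y - x))| <= e * `|y - x|) x).
  by apply: filterS h => y; rewrite !fctE /= [x + y]addrC addrK opprD addrA.
apply: filterS h => y h; rewrite dot_gradf // deriveE //.
by apply: le_trans h _; rewrite ler_pM2l // norm_le_enorm.
Qed.

(** Stated on polynomials because the derivatives along edges are only ever needed
    for restrictions to lines. *)
Lemma derive_along f a d (w : {poly R}) t :
  (forall s, f (a + s *: d) = w.[s]) -> 'D_d f (a + t *: d) = w^`().[t].
Proof.
move=> fw; rewrite derivE /derive /derive1.
set q1 := (fun _ : R => _); set q2 := (fun _ : R => _).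
suff -> : q1 = q2 by [].
apply/funext => h; rewrite /q1 /q2 /=; rewrite -!fw; congr (_ *: (f _ - _)).
by rewrite scalerDl addrCA.
Qed.

Lemma gradfD n m f g x : polyfun n f -> polyfun m g ->
  gradf (fun y => f y + g y) x = gradf f x + gradf g x.
Proof.
move=> pf pg; have df := diff_derivable (differentiable_polyfun x pf).
have dg := diff_derivable (differentiable_polyfun x pg).
by rewrite /gradf !deriveD //.
Qed.

Lemma gradfZ n f x (a : R) : polyfun n f ->
  gradf (fun y => a * f y) x = a *: gradf f x.
Proof.
move=> pf; have df := diff_derivable (differentiable_polyfun x pf).
by rewrite /gradf !deriveMl.
Qed.

Lemma eq_is_gradient D f g x u : D x -> (forall y, D y -> f y = g y) ->
  is_gradient D f x u -> is_gradient D g x u.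
Proof.
move=> Dx fg h e e0; have {}h := h e e0.
rewrite !near_withinE in h *; apply: filterS h => y h Dy.
by rewrite -!fg //; exact: h.
Qed.

Lemma is_gradient0 D x : is_gradient D (fun=> 0) x 0.
Proof.
move=> e e0; apply: nearW => y; rewrite (_ : dot 0 _ = 0) ?subrr ?subr0 ?normr0; last first.
  by rewrite /dot /= !mul0r addr0.
by rewrite mulr_ge0 ?(ltW e0) // sqrtr_ge0.
Qed.

Lemma is_gradientD D f g x u d : is_gradient D f x u -> is_gradient D g x d ->
  is_gradient D (fun y => f y + g y) x (u + d).
Proof.
move=> hf hg e e0; have e2 : 0 < e / 2 by rewrite divr_gt0.
apply: filterS2 (hf _ e2) (hg _ e2) => y h1 h2; rewrite dotDl.
rewrite (_ : _ - _ = (f y - f x - dot u (y - x)) + (g y - g x - dot d (y - x))); last by ring.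
rewrite (le_trans (ler_normD _ _)) // (le_trans (lerD h1 h2)) //.
by rewrite -mulrDl -splitr.
Qed.

Lemma is_gradientZ D f x u (a : R) : is_gradient D f x u ->
  is_gradient D (fun y => a * f y) x (a *: u).
Proof.
have [->|a0] := eqVneq a 0.
  move=> _; rewrite scale0r (_ : (fun=> _) = fun=> 0); first exact: is_gradient0.
  by apply/funext => y; rewrite mul0r.
move=> hf e e0; have ea : 0 < e / `|a| by rewrite divr_gt0 // normr_gt0.
apply: filterS (hf _ ea) => y h; rewrite dotZl -!mulrBr normrM.
apply: le_trans (ler_wpM2l (normr_ge0 a) h) _.
by rewrite mulrA mulrCA divff ?mulr1 // normr_eq0.
Qed.
End Gradients.

Section HullGradients.
Variables (R : realType) (V : 'I_3 -> R * R).
Hypothesis hV : nondegenerate_triangle V.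
Implicit Types (f g : R * R -> R) (x y d u : R * R) (i j l : 'I_3).

(** The segments from x to the three vertices stay in the triangle, and their
    directions span the plane. *)
Lemma is_gradient_unique f x u d : hull V x ->
  is_gradient (hull V) f x u -> is_gradient (hull V) f x d -> u = d.
Proof.
move=> Tx hu hd.
have key j : dot (u - d) (V j - x) = 0.
  have [->|Vx] := eqVneq (V j) x; first by rewrite subrr /dot !mulr0 addr0.
  apply/eqP; rewrite -normr_le0; apply/ler_addgt0Pr => e e0; rewrite add0r.
  set z := V j - x; have z0 : 0 < enorm z by rewrite enorm_gt0 // subr_eq0.
  have e2 : 0 < e / (2 * enorm z) by rewrite divr_gt0 // mulr_gt0.
  have h1 := hu _ e2; have h2 := hd _ e2; rewrite !near_withinE in h1 h2.
  move/nbhs_ballP: h1 => [r1 /= r10 hr1]; move/nbhs_ballP: h2 => [r2 /= r20 hr2].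
  pose r := Num.min r1 r2; have r0 : 0 < r by rewrite lt_min r10.
  pose t := Num.min 1 (r / (2 * enorm z)).
  have t0 : 0 < t by rewrite lt_min ltr01 divr_gt0 // mulr_gt0.
  have t1 : t <= 1 by rewrite ge_min lexx.
  have xr : ball x r (x + t *: z).
    rewrite -ball_normE /= opprD addNKr normrN.
    apply: le_lt_trans (norm_le_enorm _) _; rewrite enormZ ?(ltW t0) //.
    apply: (@le_lt_trans _ _ (r / 2)); last lra.
    by rewrite -ler_pdivlMr // -mulrA -invfM ge_min lexx orbT.
  have Tz : hull V (x + t *: z).
    apply/hullP => // i; rewrite bary_line [x + z]addrC subrK.
    have h3 := (hullP hV x).1 Tx i.
    have h4 := (hullP hV _).1 (vertex_hull hV j) i.
    have -> : bary V i x + t * (bary V i (V j) - bary V i x) =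
      (1 - t) * bary V i x + t * bary V i (V j) by ring.
    by rewrite addr_ge0 // mulr_ge0 ?subr_ge0 ?(ltW t0).
  have rr1 : r <= r1 by rewrite ge_min lexx.
  have rr2 : r <= r2 by rewrite ge_min lexx orbT.
  have := hr1 _ (le_ball rr1 xr) Tz; have := hr2 _ (le_ball rr2 xr) Tz.
  rewrite [x + _]addrC addrK enormZ ?(ltW t0) // !dotZr => h2 h1.
  have : `|t * dot (u - d) z| <= t * e.
    rewrite dotBl (_ : _ * _ = (f (t *: z + x) - f x - t * dot d z) -
       (f (t *: z + x) - f x - t * dot u z)); last by ring.
    rewrite (le_trans (ler_normB _ _)) // (le_trans (lerD h2 h1)) //.
    have -> // : e / (2 * enorm z) * (t * enorm z) + e / (2 * enorm z) * (t * enorm z) = t * e.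
    by field; exact: lt0r_neq0.
  by rewrite normrM gtr0_norm // ler_pM2l.
apply/eqP; rewrite -subr_eq0; apply/eqP; move: (u - d) key => w key.
have h1 : dot w (V 1 - V 0) = 0 by move: (key 0) (key 1); rewrite /dot /=; lra.
have h2 : dot w (V (-1) - V 0) = 0.
  by move: (key 0) (key (-1)); rewrite /dot /=; lra.
move: hV h1 h2; rewrite /nondegenerate_triangle.
move: (V 1 - V 0) (V (-1) - V 0) => p q; rewrite /det2 /dot.
case: w {key} => w1 w2 /= pq h1 h2.
have e1 : w1 * (p.1 * q.2 - p.2 * q.1) = 0.
  by rewrite (_ : _ * _ = (w1 * p.1 + w2 * p.2) * q.2 - (w1 * q.1 + w2 * q.2) * p.2);
    [rewrite h1 h2; ring|ring].
have e2 : w2 * (p.1 * q.2 - p.2 * q.1) = 0.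
  by rewrite (_ : _ * _ = (w1 * q.1 + w2 * q.2) * p.1 - (w1 * p.1 + w2 * p.2) * q.1);
    [rewrite h1 h2; ring|ring].
move/eqP: e1; move/eqP: e2; rewrite !mulf_eq0 !(negPf pq) !orbF.
by move=> /eqP -> /eqP ->.
Qed.

Lemma gradient_val f x u : hull V x -> is_gradient (hull V) f x u ->
  gradient (hull V) f x = u.
Proof.
move=> Tx hu; rewrite /gradient; case: xgetP => [v -> hv|/(_ u)//].
exact: is_gradient_unique hv hu.
Qed.

Lemma eq_gradient f g x : hull V x -> (forall y, hull V y -> f y = g y) ->
  gradient (hull V) f x = gradient (hull V) g x.
Proof.
move=> Tx fg; rewrite /gradient; congr (xget _ _); apply/seteqP; split=> u.
  exact: eq_is_gradient.
by apply: eq_is_gradient => // y Ty; rewrite fg.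
Qed.

(** A subtriangle that does not contain x stays away from x, so only those
    polynomial pieces matter whose subtriangle contains x.  The subtriangle of index
    l is the region where l attains the least barycentric coordinate. *)
Lemma is_gradient_glue f x i u (E : 'I_3 -> R * R -> R) :
  hull V x -> (forall l, bary V i x <= bary V l x) ->
  (forall y l, hull V y -> (forall j, bary V l y <= bary V j y) -> f y = E l y) ->
  (forall l, bary V l x = bary V i x -> is_gradient (hull V) (E l) x u) ->
  is_gradient (hull V) f x u.
Proof.
move=> Tx imin fE Eu e e0.
have near_l l : \forall y \near within (hull V) (nbhs x),
    (forall j, bary V l y <= bary V j y) ->
    `|f y - f x - dot u (y - x)| <= e * enorm (y - x).
  have [li|li] := eqVneq (bary V l x) (bary V i x).
    have := Eu l li e e0; rewrite !near_withinE; apply: filterS => y h Ty lmin.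
    rewrite (fE y l) // (fE x l) //; first exact: h.
    by move=> j; rewrite li.
  have {}li : 0 < bary V l x - bary V i x by rewrite subr_gt0 lt_neqAle eq_sym li imin.
  have c : {for x, continuous (fun y => bary V l y - bary V i y)}.
    exact: (polyfun_continuous (polyfunB (affine_polyfun (bary_is_affine V l))
                                   (affine_polyfun (bary_is_affine V i)))).
  have h : \forall y \near x, 0 < bary V l y - bary V i y by exact: (cvgr_gt _ c _ li).
  rewrite near_withinE; apply: filterS h => y h _ /(_ i).
  by move: h; rewrite subr_gt0 => h /(lt_le_trans h); rewrite ltxx.
have near_all : \forall y \near within (hull V) (nbhs x), forall l,
    (forall j, bary V l y <= bary V j y) ->
    `|f y - f x - dot u (y - x)| <= e * enorm (y - x).
  exact: filter_forall.
apply: filterS near_all => y near_y.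
pose l := [arg min_(l < i) bary V l y]%O.
apply: (near_y l) => j.
by rewrite /l; case: arg_minP => // m _; apply.
Qed.
End HullGradients.

(** * Integrals of nonnegative functions *)

Section VanishingIntegral.
Variable R : realType.

Lemma Rintegral_eq0_null (d : measure_display) (T : measurableType d)
    (mu : {measure set T -> \bar R}) (D : set T) (f : T -> R) :
  measurable D -> mu.-integrable D (EFin \o f) -> (forall x, D x -> 0 <= f x) ->
  \int[mu]_(x in D) f x = 0 ->
  exists N, [/\ measurable N, mu N = 0%E & forall x, D x -> f x != 0 -> N x].
Proof.
move=> mD fi f0 If.
have mf : measurable_fun D (EFin \o f) := measurable_int _ fi.
have I0 : (\int[mu]_(x in D) `|(EFin \o f) x| = 0)%E.
  rewrite (eq_integral (EFin \o f)) => [|x /set_mem Dx]; last first.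
    by rewrite /= ger0_norm // f0.
  have /fineK <- := integrable_fin_num mD fi.
  by rewrite -[fine _]/(\int[mu]_(x in D) f x) If.
have [N [mN N0 sN]] := (ae_eq_integral_abs mu mD mf).1 I0.
exists N; split=> // x Dx fx; apply: sN => /= /(_ Dx) [fx0].
by rewrite fx0 eqxx in fx.
Qed.

(** A weak form of f = 0 almost everywhere that is enough for continuous functions:
    apply it to small balls. *)
Lemma Rintegral_eq0_at (d : measure_display) (T : measurableType d)
    (mu : {measure set T -> \bar R}) (D : set T) (f : T -> R) (B : set T) :
  measurable D -> mu.-integrable D (EFin \o f) -> (forall x, D x -> 0 <= f x) ->
  \int[mu]_(x in D) f x = 0 ->
  measurable B -> (0 < mu B)%E -> B `<=` D ->
  exists2 x, B x & f x = 0.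
Proof.
move=> mD fi f0 If mB B0 BD; apply: contrapT => hB.
have [N [mN N0 sN]] := Rintegral_eq0_null mD fi f0 If.
have BN : B `<=` N.
  move=> x Bx; apply: sN; first exact: BD.
  by apply/eqP => fx; apply: hB; exists x.
have : (mu B <= mu N)%E by apply: le_measure => //; rewrite inE.
by rewrite N0 leNgt B0.
Qed.

Lemma Rintegral_sum (d : measure_display) (T : measurableType d)
    (mu : {measure set T -> \bar R}) (D : set T) (I : Type) (s : seq I)
    (F : I -> T -> R) : measurable D ->
  (forall z, mu.-integrable D (EFin \o F z)) ->
  mu.-integrable D (EFin \o (fun x => \sum_(z <- s) F z x)) /\
  \int[mu]_(x in D) (\sum_(z <- s) F z x) = \sum_(z <- s) \int[mu]_(x in D) F z x.
Proof.
move=> mD iF; elim: s => [|z s [ih1 ih2]].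
  have i0 : mu.-integrable D (EFin \o (fun=> 0 : R)) := integrable0 _ _.
  have -> : (fun x => \sum_(z <- [::]) F z x) = fun=> 0.
    by apply/funext => x; rewrite big_nil.
  split=> //; rewrite big_nil -[RHS](mul0r (\int[mu]_(x in D) 0)) -RintegralZl //.
  by apply: eq_Rintegral => x _; rewrite mul0r.
have -> : (fun x => \sum_(y <- z :: s) F y x) = fun x => F z x + \sum_(y <- s) F y x.
  by apply/funext => x; rewrite big_cons.
split; last by rewrite RintegralD // big_cons ih2.
by apply: eq_integrable (integrableD mD (iF z) ih1) => // x _.
Qed.

Lemma poly_integrable (w : {poly R}) :
  (@lebesgue_measure R).-integrable `[0, 1] (EFin \o horner w).
Proof.
apply: continuous_compact_integrable; first exact: segment_compact.
by apply: continuous_subspaceT => x; exact: continuous_horner.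
Qed.

Lemma poly_eq0_Rintegral (w : {poly R}) : (forall t, 0 <= t <= 1 -> 0 <= w.[t]) ->
  \int[@lebesgue_measure R]_(t in `[0, 1]) w.[t] = 0 -> w = 0.
Proof.
move=> w0 Iw.
suff h : w * 'X = 0.
  by apply/eqP; move/eqP: h; rewrite mulf_eq0 polyX_eq0 orbF.
apply: (@poly_eq0_near _ _ 1) => // t /andP[]; rewrite le_eqVlt => /orP[/eqP <- _|t0 t1].
  by rewrite !hornerE.
suff -> : w * 'X = 'X * w.
  rewrite hornerM; apply/eqP; rewrite mulf_eq0; apply/orP; right; apply/eqP.
  apply: contrapT => /eqP wt.
  have c : \forall s \near t, [/\ w.[s] != 0, 0 < s & s < 1].
    near=> s; split; near: s; last 2 first.
    - exact: lt_nbhsr.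
    - exact: lt_nbhsl.
    by have /(_ t) := @continuous_horner R w; move/cvgr_neq0; apply.
  move/nbhs_ballP: c => [r /= r0 hr].
  have w0' s : `[0, 1]%classic s -> 0 <= w.[s] by rewrite /= in_itv /=; exact: w0.
  have B0 : (0 < @lebesgue_measure R (ball t r))%E.
    by rewrite lebesgue_measure_ball ?(ltW r0) // lte_fin mulrn_wgt0.
  have BD : ball t r `<=` `[0, 1].
    by move=> s /hr[_ s0 s1] /=; rewrite in_itv /= !ltW.
  have [||s Bs ws] := Rintegral_eq0_at _ (poly_integrable w) w0' Iw _ B0 BD.
  - exact: measurable_itv.
  - exact: measurable_ball.
  by have [] := hr _ Bs; rewrite ws eqxx.
by rewrite mulrC.
Unshelve. all: by end_near. Qed.
End VanishingIntegral.

(** * Integration over the triangle *)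

Section HullIntegrals.
Variables (R : realType) (V : 'I_3 -> R * R).
Hypothesis hV : nondegenerate_triangle V.
Implicit Types (f g F : R * R -> R) (x : R * R) (i : 'I_3).

Lemma measurable_hull : measurable (hull V).
Proof.
have mi i : measurable [set x | 0 <= bary V i x].
  have := polyfun_measurable (affine_polyfun (bary_is_affine V i)).
  move=> /(_ measurableT _ (measurable_itv `[0, +oo[)); rewrite setTI.
  by congr measurable; apply/seteqP; split=> x /=; rewrite in_itv /= andbT.
pose A i := [set x | 0 <= bary V i x].
rewrite (_ : hull V = A 0 `&` A 1 `&` A (-1)).
  by apply: measurableI; [apply: measurableI|]; exact: mi.
apply/seteqP; split=> [x /(hullP hV) h|x [[h0 h1] h2]].
  by split; [split|]; exact: h.
by apply/(hullP hV) => i; have [] := ord3E i => ->.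
Qed.

Definition box M : set (R * R) := `[- M, M] `*` `[- M, M].

(** Boundedness of the triangle, for finiteness of its measure and for boundedness of
    continuous functions on it. *)
Lemma hull_box : exists M, hull V `<=` box M.
Proof.
exists (\sum_i `|V i|) => x Tx.
have b1 i : 0 <= bary V i x <= 1.
  have h := (hullP hV x).1 Tx; rewrite h /= -(bary_sum_cyc hV i x).
  by rewrite -addrA lerDl addr_ge0.
have xM : `|x| <= \sum_i `|V i|.
  rewrite -[in `|x|](bary_comb x hV); apply: le_trans (ler_norm_sum _ _ _) _.
  apply: ler_sum => i _; have /andP[h0 h1] := b1 i.
  by rewrite normrZ ger0_norm // ler_piMl.
move: xM; rewrite prod_normE /= ge_max !ler_norml => /andP[h1 h2].
by split; rewrite /= in_itv.
Qed.

Lemma hull_fin : (@plane_measure R (hull V) < +oo)%E.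
Proof.
have [M hM] := hull_box.
have : (@plane_measure R (hull V) <= @plane_measure R (box M))%E.
  apply: le_measure => //; rewrite inE; first exact: measurable_hull.
  by apply: measurableX; exact: measurable_itv.
move=> /le_lt_trans; apply.
rewrite /plane_measure product_measure1E; [|exact: measurable_itv..].
rewrite -[ltLHS]/(@lebesgue_measure R `[(- M)%R, M]%classic *
  @lebesgue_measure R `[(- M)%R, M]%classic)%E.
rewrite !lebesgue_measure_itv /=; case: ifPn => _; last by rewrite mul0e ltry.
by rewrite -EFinB -EFinM ltry.
Qed.

(** Measurability for the product sigma-algebra is carried along with continuity
    rather than deduced from it. *)
Definition meas_cont F := measurable_fun [set: R * R] F /\ continuous F.

Lemma hull_integrable F : meas_cont F ->
  (@plane_measure R).-integrable (hull V) (EFin \o F).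
Proof.
move=> [mF cF]; have [M hM] := hull_box.
apply: measurable_bounded_integrable; [exact: measurable_hull|exact: hull_fin| |].
  exact: measurable_funTS.
have /compact_bounded bF : compact (F @` box M).
  apply: continuous_compact; first exact: continuous_subspaceT.
  by apply: compact_setX; exact: segment_compact.
case: bF => B [Br hB]; exists B; split=> // r Mr x Tx.
by apply: (hB r Mr); exists x => //; exact: hM.
Qed.

Lemma ball_measure x r : 0 < r -> (0 < @plane_measure R (ball x r))%E.
Proof.
move=> r0; rewrite (_ : ball x r = ball x.1 r `*` ball x.2 r) //.
rewrite /plane_measure product_measure1E; [|exact: measurable_ball..].
rewrite -[ltRHS]/(@lebesgue_measure R (ball x.1 r) * @lebesgue_measure R (ball x.2 r))%E.
by rewrite !lebesgue_measure_ball ?(ltW r0) // mule_gt0 // lte_fin mulrn_wgt0.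
Qed.

(** Balls are the sets of positive measure inside the triangle that the
    integration arguments use. *)
Lemma interior_ball x (P : R * R -> Prop) : (forall i, 0 < bary V i x) ->
  (\forall y \near x, P y) ->
  exists2 r, 0 < r & ball x r `<=` [set y | hull V y /\ P y].
Proof.
move=> x0 Px.
have c : \forall y \near x, forall i, 0 < bary V i y.
  have ci i : \forall y \near x, 0 < bary V i y.
    have cb := polyfun_continuous (affine_polyfun (bary_is_affine V i)) (x := x).
    exact: (cvgr_gt _ cb _ (x0 i)).
  exact: (@filter_forall _ _ (fun i => [set y | 0 < bary V i y]) _ _ ci).
have /nbhs_ballP[r r0 hr] : \forall y \near x, (forall i, 0 < bary V i y) /\ P y.
  by near=> y; split; near: y.
exists r => // y /hr[h Py]; split=> //.
by apply/(hullP hV) => i; exact: ltW.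
Unshelve. all: by end_near. Qed.

Lemma Rintegral_hull_eq0 F : meas_cont F -> (forall x, hull V x -> 0 <= F x) ->
  \int[@plane_measure R]_(x in hull V) F x = 0 ->
  forall x, (forall i, 0 < bary V i x) -> F x = 0.
Proof.
move=> tF F0 IF x x0; apply: contrapT => /eqP Fx.
have c : \forall y \near x, F y != 0 by have /cvgr_neq0 := tF.2 x; apply.
have [r r0 hr] := interior_ball x0 c.
have BT : ball x r `<=` hull V by move=> y /hr[].
have [||s Bs ws] := Rintegral_eq0_at _ (hull_integrable tF) F0 IF _ (ball_measure x r0) BT.
- exact: measurable_hull.
- rewrite (_ : ball x r = ball x.1 r `*` ball x.2 r) //.
  by apply: measurableX; exact: measurable_ball.
by have [_] := hr _ Bs; rewrite ws eqxx.
Qed.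

(** The enrichment functions carry the factor |T|^2; were it zero, they would vanish
    and could not contribute three dimensions to U. *)
Lemma area_neq0 : area V != 0.
Proof.
have b0 i : 0 < bary V i (barycenter V) by rewrite barycenter_bary // invr_gt0.
have [r r0 hr] := interior_ball b0 (filterT : \forall y \near _, True).
rewrite /area fine_eq0 ?ge0_fin_numE ?hull_fin // gt_eqF //.
apply: lt_le_trans (ball_measure (barycenter V) r0) _.
apply: le_measure; rewrite ?inE; [|exact: measurable_hull|by move=> y /hr[]].
rewrite (_ : ball _ r = ball (barycenter V).1 r `*` ball (barycenter V).2 r) //.
by apply: measurableX; exact: measurable_ball.
Qed.

Lemma meas_cont_polyfun n f : polyfun n f -> meas_cont f.
Proof. by move=> pf; split; [exact: polyfun_measurable pf|exact: polyfun_continuous pf]. Qed.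

Lemma meas_contD f g : meas_cont f -> meas_cont g -> meas_cont (fun x => f x + g x).
Proof.
move=> [mf cf] [mg cg]; split; first exact: measurable_funD.
by move=> x; apply: cvgD; [exact: cf|exact: cg].
Qed.

Lemma meas_contM f g : meas_cont f -> meas_cont g -> meas_cont (fun x => f x * g x).
Proof.
move=> [mf cf] [mg cg]; split; first exact: measurable_funM.
by move=> x; apply: cvgM; [exact: cf|exact: cg].
Qed.

Lemma meas_cont_min f g : meas_cont f -> meas_cont g -> meas_cont (fun x => Num.min (f x) (g x)).
Proof.
move=> [mf cf] [mg cg]; split; first exact: measurable_minr.
by move=> x; apply: continuous_min; [exact: cf|exact: cg].
Qed.

Lemma meas_cont_cst (a : R) : meas_cont (fun=> a).
Proof. exact: meas_cont_polyfun (polyfun_cst 0 a). Qed.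

Lemma meas_contX f n : meas_cont f -> meas_cont (fun x => f x ^+ n).
Proof.
move=> tf; elim: n => [|n ih]; first exact: meas_cont_cst.
under eq_fun do rewrite exprS; exact: meas_contM.
Qed.

End HullIntegrals.

(** * Dimension counting *)

Section LinearAlgebra.
Variable R : realType.

(** The matrix M has full row rank, hence at most as many rows as columns; if it
    is square then it has full column rank as well. *)
Lemma injective_card (I K : finType) (M : I -> K -> R) :
  (forall u : I -> R, (forall k, \sum_i u i * M i k = 0) -> forall i, u i = 0) ->
  (#|I| <= #|K|)%N /\ ((#|K| <= #|I|)%N ->
    forall d : K -> R, exists u : I -> R, forall k, \sum_i u i * M i k = d k).
Proof.
move=> Minj.
pose A := \matrix_(i < #|I|, k < #|K|) M (enum_val i) (enum_val k).
have mulA (v : 'rV_#|I|) k :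
    (v *m A) 0 k = \sum_i v 0 (enum_rank i) * M i (enum_val k).
  rewrite mxE [RHS](reindex (@enum_val I I)) /=.
    by apply: eq_bigr => i _; rewrite mxE enum_valK.
  by apply: onW_bij; exact: enum_val_bij.
have fA : row_free A.
  apply: inj_row_free => v vA; apply/rowP => i; rewrite mxE.
  rewrite -(enum_valK i); apply: (Minj (fun i => v 0 (enum_rank i))) => k.
  have := mulA v (enum_rank k); rewrite vA mxE enum_rankK => <-.
  by [].
split; first by rewrite -(eqP fA) rank_leq_col.
move=> KI d.
have fullA : row_full A by rewrite /row_full eqn_leq rank_leq_col (eqP fA).
have /submxP[v vE] := submx_full (\row_k d (enum_val k)) fullA.
exists (fun i => v 0 (enum_rank i)) => k.
have := mulA v (enum_rank k); rewrite -vE mxE enum_rankK => <-.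
by [].
Qed.

(** A basis is no longer than a spanning family: expand the basis in the spanning
    family and apply [injective_card] to the coefficients. *)
Lemma is_basis_le (D : set (R * R)) (W : set (R * R -> R)) m
    (b : 'I_m -> R * R -> R) (K : finType) (g : K -> R * R -> R) :
  W (fun=> 0) ->
  (forall f, W f -> exists u : K -> R, forall x, D x -> f x = \sum_z u z * g z x) ->
  is_basis D W b -> (m <= #|K|)%N.
Proof.
move=> W0 Wg [Wb bU].
have [M ME] := choice (fun j => Wg _ (Wb j)).
rewrite -[m]card_ord; apply: (injective_card (M := M) _).1 => u uM i.
have [c [_ cU]] := bU _ W0.
have <- : c = u.
  apply: cU => x Dx.
  rewrite [RHS](eq_bigr (fun j => \sum_z u j * M j z * g z x)) => [|j _].
    rewrite exchange_big big1 // => z _.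
    by rewrite -mulr_suml uM mul0r.
  by rewrite ME // mulr_sumr; apply: eq_bigr => z _; rewrite mulrA.
rewrite (cU (fun=> 0)) // => x _.
by rewrite big1 // => j _; rewrite mul0r.
Qed.
End LinearAlgebra.

(** * A basis of the polynomial functions *)

Section PolynomialBasis.
Variable R : realType.
Implicit Types (f g : R * R -> R) (D : set (R * R)).

Lemma polyfun_monomial n i j (a : R) : (i + j < n)%N ->
  polyfun n (fun x => a * x.1 ^+ i * x.2 ^+ j).
Proof.
move=> ijn.
have a1 : affine (fun x : R * R => x.1) by exists 1, 0, 0 => x; ring.
have a2 : affine (fun x : R * R => x.2) by exists 0, 1, 0 => x; ring.
have := polyfunM_affineX i a1 (polyfunM_affineX j a2 (polyfun_cst 0 a)).
rewrite addnA addn1 => /(polyfun_le ijn); apply: eq_polyfun => x; ring.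
Qed.

Lemma polyOn_polyfun (m : int) n D f : (forall d : nat, d%:Z <= m -> (d < n)%N) ->
  polyOn m D f -> exists2 g, polyfun n g & forall x, D x -> f x = g x.
Proof.
move=> mn [p [pm fE]].
exists (fun x => p.[x.2%:P].[x.1]) => //.
have -> : (fun x : R * R => p.[x.2%:P].[x.1]) =
    fun x => \sum_(j < size p) \sum_(i < size p`_j) p`_j`_i * x.1 ^+ i * x.2 ^+ j.
  apply/funext => x; rewrite [horner p _]horner_coef horner_sum; apply: eq_bigr => j _.
  rewrite hornerM -polyC_exp hornerC horner_coef mulr_suml.
  by apply: eq_bigr => i _.
apply: polyfun_sum => j _; apply: polyfun_sum => i _.
have [->|pij] := eqVneq p`_j`_i 0.
  by apply: eq_polyfun (polyfun0 _ _) => x; rewrite !mul0r.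
by apply: polyfun_monomial; apply: mn; exact: pm.
Qed.

Lemma polyfun_polyOn (m : int) n D f : (forall d : nat, (d < n)%N -> d%:Z <= m) ->
  polyfun n f -> polyOn m D f.
Proof.
move=> nm pf.
suff [p pn pE] : exists2 p : {poly {poly R}},
    (forall i j, p`_j`_i != 0 -> (i + j < n)%N) & forall x, f x = p.[x.2%:P].[x.1].
  by exists p; split => // i j /pn; exact: nm.
elim: n f pf {nm} => [f f0|n ih f [c [g [h [/ih[p pn pE] /ih[q qn qE] fE]]]]].
  by exists 0 => [i j|x]; rewrite ?coef0 ?eqxx ?horner0 ?f0.
exists (c%:P%:P + 'X%:P * p + 'X * q) => [i j|x]; last first.
  by rewrite fE pE qE !hornerE.
rewrite !coefD coefCM coefXM coefXM !coefC.
case: i j => [|i] [|j] /=; rewrite ?coefC ?coef0 ?addr0 ?add0r /=.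
- by [].
- by move/qn; rewrite add0n ltnS.
- by move/pn; rewrite !addn0.
- have [/pn|] := boolP (p`_j.+1`_i != 0).
    by rewrite addSn.
  by rewrite negbK => /eqP ->; rewrite add0r => /qn; rewrite addnS.
Qed.

(** Index set of a monomial basis of [polyfun n], following the decomposition
    f(x1, x2) = f(x1, 0) + x2 h(x1, x2) given by division by x2; this makes spanning
    and independence one induction each. *)
Fixpoint monomialT n : finType :=
  if n is m.+1 then ('I_m.+1 + monomialT m)%type : finType else void.

Fixpoint monomial n : monomialT n -> R * R -> R :=
  match n with
  | 0 => fun _ _ => 0
  | m.+1 => fun z x => match z with inl i => x.1 ^+ i | inr z' => x.2 * monomial z' x end
  end.

Lemma card_monomialT n : #|monomialT n.+1| = (n.+1 + #|monomialT n|)%N.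
Proof. by rewrite card_sum card_ord. Qed.

Lemma card_monomialT0 : #|monomialT 0| = 0%N.
Proof. exact: card_void. Qed.

Lemma monomial_polyfun n (z : monomialT n) : polyfun n (monomial z).
Proof.
elim: n z => [//|n ih [i|z]].
  apply: eq_polyfun (@polyfun_monomial n.+1 i 0 1 _) => [x|]; first by rewrite mul1r mulr1.
  by rewrite addn0.
have a2 : affine (fun x : R * R => x.2) by exists 0, 1, 0 => x; ring.
exact: (polyfunM_affine a2 (ih z)).
Qed.

Lemma sum_monomialT n (u : monomialT n.+1 -> R) x :
  \sum_z u z * monomial z x =
  \sum_(i < n.+1) u (inl i) * x.1 ^+ i + x.2 * \sum_z u (inr z) * monomial z x.
Proof.
by rewrite big_sumType /= mulr_sumr; congr (_ + _); apply: eq_bigr => z _; ring.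
Qed.

Lemma monomial_span n f : polyfun n f ->
  exists u : monomialT n -> R, forall x, f x = \sum_z u z * monomial z x.
Proof.
elim: n f => [f f0|n ih f pf].
  by exists (fun=> 0) => x; rewrite f0 big1 // => -[].
have [w sw wE] := polyfun_line (0, 0) (1, 0) pf.
have fw t : f (t, 0) = w.[t].
  by rewrite -wE; congr f; congr pair; rewrite /= /GRing.scale /=; ring.
have pg : polyfun n.+1 (fun x => f x - \sum_(i < n.+1) w`_i * x.1 ^+ i).
  apply: polyfunB => //; apply: polyfun_sum => i _.
  apply: eq_polyfun (@polyfun_monomial n.+1 i 0 w`_i _) => [x|]; first by rewrite mulr1.
  by rewrite addn0.
have [t|h /ih[u uE] hE] := polyfun_div_axis pg.
  by rewrite fw (horner_coef_wide _ sw) subrr.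
exists (fun z : monomialT n.+1 => match z with inl i => w`_i | inr z' => u z' end) => x.
by rewrite sum_monomialT -uE -hE addrC subrK.
Qed.

Lemma monomial_free n (u : monomialT n -> R) :
  (forall x, \sum_z u z * monomial z x = 0) -> forall z, u z = 0.
Proof.
elim: n u => [u _ []//|n ih u u0].
pose w := \poly_(i < n.+1) u (inl (inord i)).
have w0 : w = 0.
  apply: (@poly_eq0_near _ _ 1) => // t _; rewrite horner_poly.
  rewrite -[RHS](u0 (t, 0)) sum_monomialT mul0r addr0.
  by apply: eq_bigr => i _; rewrite inord_val.
have ul i : u (inl i) = 0.
  by have := coef_poly n.+1 (fun i => u (inl (inord i))) i; rewrite -/w w0 coef0 ltn_ord inord_val.
have ur z : u (inr z) = 0.
  apply: (ih (fun z => u (inr z))) => x.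
  have pf : polyfun n (fun x => \sum_z u (inr z) * monomial z x).
    by apply: polyfun_sum => z' _; apply: polyfunZ; exact: monomial_polyfun.
  have [v _ vE] := polyfun_line (x.1, 0) (0, 1) pf.
  have {}vE s : \sum_z u (inr z) * monomial z (x.1, s) = v.[s].
    rewrite -vE; apply: eq_bigr => z' _; congr (_ * monomial z' _).
    by congr pair; rewrite /= /GRing.scale /=; ring.
  suff v0 : v = 0 by have := vE x.2; rewrite v0 horner0 -surjective_pairing.
  have : 'X * v = 0.
    apply: (@poly_eq0_near _ _ 1) => // s _; rewrite hornerM hornerX -vE.
    have := u0 (x.1, s); rewrite sum_monomialT /= big1 ?add0r // => i _.
    by rewrite ul mul0r.
  by move/eqP; rewrite mulf_eq0 polyX_eq0 => /eqP.
by case.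
Qed.
End PolynomialBasis.

Lemma derive_mulX (R : realType) (W : normedModType R) (f g : W -> R) (x d : W)
    (a : R) n : derivable f x d -> derivable g x d ->
  'D_d (fun y => a * f y ^+ n.+1 * g y) x =
  a * n.+1%:R * f x ^+ n * g x * 'D_d f x + a * f x ^+ n.+1 * 'D_d g x.
Proof.
move=> df dg.
have dfn := @derivableX _ _ f n.+1 x d df.
have dm := derivableM dfn dg.
have -> : (fun y => a * f y ^+ n.+1 * g y) = a *: (f ^+ n.+1 * g).
  by apply/funext => y; rewrite !fctE /GRing.scale /= mulrA.
rewrite (deriveZ a dm) (deriveM dfn dg) (@deriveX _ _ f n.+1 x d df).
by rewrite !fctE /GRing.scale /=; ring.
Qed.

(** * The refined hats and the enrichment on each subtriangle *)

Section RefinedHat.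
Variables (R : realType) (V : 'I_3 -> R * R).
Hypothesis hV : nondegenerate_triangle V.
Implicit Types (f g : R * R -> R) (x : R * R) (i j l : 'I_3).

Definition min_bary x := Num.min (bary V 0 x) (Num.min (bary V 1 x) (bary V (-1) x)).

Lemma min_baryE l x : (forall j, bary V l x <= bary V j x) -> min_bary x = bary V l x.
Proof.
move=> h; rewrite /min_bary; have [h0 h1 h2] := And3 (h 0) (h 1) (h (-1)).
apply/eqP; rewrite eq_le; apply/andP; split; last by rewrite !le_min h0 h1 h2.
by have [] := ord3E l => ->; rewrite !ge_min lexx ?orbT.
Qed.

Lemma ex_min_bary x : exists l, forall j, bary V l x <= bary V j x.
Proof.
exists [arg min_(l < (0 : 'I_3)) bary V l x]%O => j.
by case: arg_minP => // m _; apply.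
Qed.

Lemma polyOn1_affine D f : polyOn 1 D f ->
  exists2 g, affine g & forall x, D x -> f x = g x.
Proof.
case/(@polyOn_polyfun _ _ 2) => // g [c [g1 [g2 [p1 p2 gE]]]] fg.
have cst_g h : polyfun 1 h -> exists a, forall x, h x = a.
  move=> [a [h1 [h2 [q1 q2 hE]]]]; exists a => x.
  by rewrite hE q1 q2 !mulr0 !addr0.
have [a1 E1] := cst_g _ p1; have [a2 E2] := cst_g _ p2.
exists g => //; exists a1, a2, c => x; rewrite gE E1 E2; ring.
Qed.

Lemma affine_comb g (t : 'I_3 -> R) (W : 'I_3 -> R * R) : affine g -> \sum_j t j = 1 ->
  g (\sum_j t j *: W j) = \sum_j t j * g (W j).
Proof.
move=> [a [b [c h]]]; rewrite !sum_ord3 !h /= /GRing.scale /= => ht.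
by rewrite -[c in LHS]mul1r -ht; ring.
Qed.

(** Both sides are affine on subtriangle [l] and agree at its three vertices.  The
    point x has weight 3 l_l at the barycenter and weights l_j - l_l at the other two
    vertices of that subtriangle. *)
Lemma refined_hatE i l f x : is_refined_hat V i f -> hull V x ->
  (forall j, bary V l x <= bary V j x) -> f x = bary V i x - bary V l x.
Proof.
move=> [_ fpoly fV fc] Tx lmin; have [g ag gE] := polyOn1_affine (fpoly l).
pose W j := if j == l then barycenter V else V j.
pose t j := if j == l then 3 * bary V l x else bary V j x - bary V l x.
have t1 : \sum_j t j = 1.
  by rewrite (sum_cyc _ l) /t eqxx !ord3_neq -[RHS](bary_sum_cyc hV l x); ring.
have xE : x = \sum_j t j *: W j.
  rewrite -[LHS](bary_comb x hV) !(sum_cyc _ l) /t /W eqxx !ord3_neq /barycenter (sum_cyc _ l).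
  move: (bary V l x) (bary V (l + 1) x) (bary V (l - 1) x) => a b c.
  case: (V l) (V (l + 1)) (V (l - 1)) => [a1 a2] [b1 b2] [c1 c2].
  by congr pair; rewrite /= /GRing.scale /=; field.
have t0 j : 0 <= t j.
  rewrite /t; case: eqP => _; last by rewrite subr_ge0.
  by rewrite mulr_ge0 //; exact: (hullP hV x).1.
have Wl j : subtriangle V l (W j).
  exists (fun m => (m == j)%:R); split=> [m||]; rewrite ?ler0n //.
    by rewrite (bigD1 j) //= eqxx big1 ?addr0 // => m /negPf ->.
  rewrite (bigD1 j) //= eqxx scale1r big1 ?addr0 // => m /negPf ->.
  by rewrite scale0r.
rewrite gE; last by exists t.
rewrite [in LHS]xE affine_comb // (eq_bigr (fun j => t j * f (W j))); last first.
  by move=> j _; rewrite gE.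
rewrite (sum_cyc _ l) /t /W eqxx !ord3_neq fc !fV mulr0 add0r.
by have [->|->|->] := ord3_cases l i; rewrite ?eqxx ?ord3_neq /=; ring.
Qed.
End RefinedHat.

Section Pieces.
Variables (R : realType) (V : 'I_3 -> R * R) (k : nat).
Hypotheses (hV : nondegenerate_triangle V) (hk : (2 <= k)%N).
Implicit Types (f g v : R * R -> R) (x : R * R) (i j l : 'I_3).

Definition enrichment_cst : R := 4 * area V ^+ 2 / (9 * k.+1%:R).

Lemma enrichment_cst_neq0 : enrichment_cst != 0.
Proof.
rewrite /enrichment_cst mulf_neq0 ?invr_neq0 // mulf_neq0 ?pnatr_eq0 //.
by rewrite expf_neq0 // area_neq0.
Qed.

(** The polynomial that coincides with enrichment function [i] on subtriangle [l].
    The formula is uniform in [l]: for l = i it is 0, as it should be. *)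
Definition enrichment_piece i l x : R := enrichment_cst *
  (bary V i x - bary V l x) ^+ k.+1 * (bary V (i - 1) x - bary V (i + 1) x).

Lemma affineB f g : affine f -> affine g -> affine (fun x => f x - g x).
Proof.
move=> [a [b [c fE]]] [a' [b' [c' gE]]]; exists (a - a'), (b - b'), (c - c') => x.
by rewrite fE gE; ring.
Qed.

Lemma affine_baryB i j : affine (fun x => bary V i x - bary V j x).
Proof. by apply: affineB; exact: bary_is_affine. Qed.

Lemma enrichment_piece_polyfun i l : polyfun k.+3 (enrichment_piece i l).
Proof.
have := polyfunM_affineX k.+1 (affine_baryB i l)
  (affine_polyfun (affine_baryB (i - 1) (i + 1))).
rewrite addn2 => /(polyfunZ enrichment_cst); apply: eq_polyfun => x.
by rewrite /enrichment_piece mulrA.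
Qed.

Lemma gradfB n m f g x : polyfun n f -> polyfun m g ->
  gradf (fun y => f y - g y) x = gradf f x - gradf g x.
Proof.
move=> pf pg; have df d := diff_derivable (v := d) (differentiable_polyfun x pf).
have dg d := diff_derivable (v := d) (differentiable_polyfun x pg).
by rewrite /gradf (deriveB (df _) (dg _)) (deriveB (df _) (dg _)).
Qed.

(** On edge [l] this shows how far the gradient depends on [l]: only through the
    first summand, whose scalar factor vanishes at the vertices. *)
Lemma gradf_enrichment_piece i l x : bary V l x = 0 ->
  gradf (enrichment_piece i l) x =
  (enrichment_cst * k.+1%:R * bary V i x ^+ k * (bary V (i - 1) x - bary V (i + 1) x)) *:
    (gradf (bary V i) x - gradf (bary V l) x)
  + (enrichment_cst * bary V i x ^+ k.+1) *:
    (gradf (bary V (i - 1)) x - gradf (bary V (i + 1)) x).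
Proof.
move=> xl; have pb j := affine_polyfun (bary_is_affine V j).
have dB d i1 i2 : derivable (fun y => bary V i1 y - bary V i2 y) x d.
  exact: diff_derivable (differentiable_polyfun x (polyfunB (pb i1) (pb i2))).
rewrite -!(gradfB _ (pb _) (pb _)) /gradf /enrichment_piece.
rewrite !(derive_mulX _ _ (dB _ _ _) (dB _ _ _)).
by rewrite xl subr0.
Qed.
End Pieces.

(** * Values and gradients along the edges *)

Section Traces.
Variables (R : realType) (V : 'I_3 -> R * R).
Hypothesis hV : nondegenerate_triangle V.
Implicit Types (f g v : R * R -> R) (x : R * R) (i j l : 'I_3).

(** The polynomials [P i] describe [v] to first order along edge [i].  This is all that
    the vertex and edge degrees of freedom see of [v]. *)
Definition traces n v (P : 'I_3 -> R * R -> R) :=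
  (forall i, polyfun n (P i)) /\
  forall i t, 0 <= t <= 1 -> v (edge_point V i t) = P i (edge_point V i t) /\
    is_gradient (hull V) v (edge_point V i t) (gradf (P i) (edge_point V i t)).

Lemma traces_polyfun n p : polyfun n p -> traces n p (fun=> p).
Proof.
move=> pp; split=> // i t t01; split=> //.
by apply: is_gradient_gradf; exact: differentiable_polyfun pp.
Qed.

Lemma tracesD n v g P Q : traces n v P -> traces n g Q ->
  traces n (fun x => v x + g x) (fun i x => P i x + Q i x).
Proof.
move=> [pP vP] [pQ gQ]; split=> [i|i t t01]; first exact: polyfunD.
have [v1 v2] := vP i t t01; have [g1 g2] := gQ i t t01.
rewrite v1 g1 (gradfD _ (pP i) (pQ i)); split=> //; exact: is_gradientD.
Qed.

Lemma tracesZ n v P (a : R) : traces n v P ->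
  traces n (fun x => a * v x) (fun i x => a * P i x).
Proof.
move=> [pP vP]; split=> [i|i t t01]; first exact: polyfunZ.
have [v1 v2] := vP i t t01.
by rewrite v1 (gradfZ _ _ (pP i)); split=> //; exact: is_gradientZ.
Qed.

Lemma traces_sum n (I : Type) (s : seq I) (v : I -> R * R -> R) P :
  (forall z, traces n (v z) (P z)) ->
  traces n (fun x => \sum_(z <- s) v z x) (fun i x => \sum_(z <- s) P z i x).
Proof.
move=> vP; elim: s => [|z s ih].
  have -> : (fun x => \sum_(z <- [::]) v z x) = fun=> 0.
    by apply/funext => x; rewrite big_nil.
  have -> : (fun i x => \sum_(z <- [::]) P z i x) = fun=> fun=> 0.
    by apply/funext => i; apply/funext => x; rewrite big_nil.
  exact: traces_polyfun (polyfun0 _ _).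
have -> : (fun x => \sum_(y <- z :: s) v y x) = fun x => v z x + \sum_(y <- s) v y x.
  by apply/funext => x; rewrite big_cons.
have -> : (fun i x => \sum_(y <- z :: s) P y i x) =
    fun i x => P z i x + \sum_(y <- s) P y i x.
  by apply/funext => i; apply/funext => x; rewrite big_cons.
exact: tracesD.
Qed.

(** What the linearity of the degrees of freedom requires: gradients that exist along
    the edges, with polynomial traces, and integrability over the triangle. *)
Definition admissible n v := (exists P, traces n v P) /\
  exists2 F, meas_cont F & forall x, hull V x -> v x = F x.

Lemma admissible_polyfun n p : polyfun n p -> admissible n p.
Proof.
move=> pp; split; first by exists (fun=> p); exact: traces_polyfun.
by exists p => //; exact: meas_cont_polyfun pp.
Qed.

Lemma traces_gradient n v P i t : traces n v P -> 0 <= t <= 1 ->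
  gradient (hull V) v (edge_point V i t) = gradf (P i) (edge_point V i t).
Proof.
move=> [_ vP] t01; apply: gradient_val => //; first exact: edge_hull.
by have [] := vP i t t01.
Qed.
End Traces.

Section EnrichmentTraces.
Variables (R : realType) (V : 'I_3 -> R * R) (k : nat).
Hypotheses (hV : nondegenerate_triangle V) (hk : (2 <= k)%N).
Variable lamR : 'I_3 -> R * R -> R.
Hypothesis hlamR : forall i, is_refined_hat V i (lamR i).
Implicit Types (x : R * R) (i j l : 'I_3).

Lemma enrichmentE i l x : hull V x -> (forall j, bary V l x <= bary V j x) ->
  enrichment V k lamR i x = enrichment_piece V k i l x.
Proof. by move=> Tx lmin; rewrite /enrichment (refined_hatE hV (hlamR i) Tx lmin). Qed.

(** At an inner point of edge [l] only subtriangle [l] is near.  At a vertex a second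
    subtriangle [m] meets it, and by [gradf_enrichment_piece] the two gradients agree
    there: if [i] is that vertex then l_(i-1) = l_(i+1) = 0, otherwise l_i = 0 and
    k > 0. *)
Lemma enrichment_traces i : traces V k.+3 (enrichment V k lamR i) (enrichment_piece V k i).
Proof.
split=> [l|l t t01]; first exact: enrichment_piece_polyfun.
have Te := edge_hull hV l t01; have [xl _ _] := bary_edge hV l t.
move: (edge_point V l t) Te xl => x Tx xl.
have lmin j : bary V l x <= bary V j x by rewrite xl; exact: (hullP hV x).1.
split; first exact: enrichmentE.
apply: (is_gradient_glue (i := l) (E := enrichment_piece V k i)) => // [y m|m].
  exact: enrichmentE.
rewrite xl => xm; suff <- : gradf (enrichment_piece V k i m) x = gradf (enrichment_piece V k i l) x.
  by apply: is_gradient_gradf; exact: differentiable_polyfun (enrichment_piece_polyfun V k i m).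
rewrite (gradf_enrichment_piece k i xm) (gradf_enrichment_piece k i xl).
have [->//|ml] := eqVneq m l.
have [xi|] := eqVneq (bary V i x) 0.
  have k0 : (k == 0)%N = false by rewrite gtn_eqF // (ltn_trans _ hk).
  by rewrite xi !expr0n k0 /= !mulr0 !mul0r !scale0r.
move=> xi; suff -> : bary V (i - 1) x - bary V (i + 1) x = 0 by rewrite !mulr0 !scale0r.
have [e1|e1|e1] := ord3_cases i l; have [e2|e2|e2] := ord3_cases i m;
  first [ by rewrite -e1 xl eqxx in xi | by rewrite -e2 xm eqxx in xi
        | by rewrite e1 e2 eqxx in ml | by rewrite -e1 -e2 xl xm subrr ].
Qed.

(** The refined hat is known only on the triangle; there l_i - min_j l_j
    represents it by a function that is continuous on the whole plane. *)
Lemma enrichment_admissible i : admissible V k.+3 (enrichment V k lamR i).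
Proof.
split; first by exists (enrichment_piece V k i); exact: enrichment_traces.
have tb j : meas_cont (bary V j) by exact: meas_cont_polyfun (affine_polyfun (bary_is_affine V j)).
exists (fun x => enrichment_cst V k * (bary V i x + (-1) * min_bary V x) ^+ k.+1 *
    (bary V (i - 1) x + (-1) * bary V (i + 1) x)).
  apply: meas_contM; last by apply: meas_contD => //; apply: meas_contM => //; exact: meas_cont_cst.
  apply: meas_contM; first exact: meas_cont_cst.
  apply: meas_contX; apply: meas_contD => //; apply: meas_contM; first exact: meas_cont_cst.
  by apply: meas_cont_min => //; exact: meas_cont_min.
move=> x Tx; have [l lmin] := ex_min_bary V x.
by rewrite (enrichmentE i Tx lmin) (min_baryE lmin) !mulN1r.
Qed.
End EnrichmentTraces.

(** * Edge integrals *)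

Section EdgeIntegrals.
Variables (R : realType) (V : 'I_3 -> R * R).
Hypothesis hV : nondegenerate_triangle V.
Implicit Types (f g v : R * R -> R) (x : R * R) (i j l : 'I_3).

Definition edge_poly i f :=
  exists w : {poly R}, forall t, 0 <= t <= 1 -> f (edge_point V i t) = w.[t].

Lemma edge_polyD i f g : edge_poly i f -> edge_poly i g ->
  edge_poly i (fun x => f x + g x).
Proof.
move=> [u fu] [w gw]; exists (u + w) => t t01.
by rewrite hornerD fu ?gw.
Qed.

Lemma edge_polyM i f g : edge_poly i f -> edge_poly i g ->
  edge_poly i (fun x => f x * g x).
Proof.
move=> [u fu] [w gw]; exists (u * w) => t t01.
by rewrite hornerM fu ?gw.
Qed.

Lemma edge_polyZ i f (a : R) : edge_poly i f -> edge_poly i (fun x => a * f x).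
Proof. by move=> [u fu]; exists (a *: u) => t t01; rewrite hornerZ fu. Qed.

Lemma polyfun_edge_poly i n f : polyfun n f -> edge_poly i f.
Proof.
move=> pf; have [w _ wE] := polyfun_line (V (i + 1)) (edge_vec V i) pf.
by exists w => t _; exact: wE.
Qed.

Lemma edge_pointP i t : 0 <= t <= 1 -> edge V i (edge_point V i t).
Proof. by move=> t01; exists t => //=; rewrite in_itv. Qed.

Lemma eq_edge_poly i f g : (forall x, edge V i x -> f x = g x) ->
  edge_poly i g -> edge_poly i f.
Proof.
by move=> fg [w gw]; exists w => t t01; rewrite fg ?gw //; exact: edge_pointP.
Qed.

Lemma edge_integralE i f (w : {poly R}) :
  (forall t, 0 <= t <= 1 -> f (edge_point V i t) = w.[t]) ->
  edge_integral V i f =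
  enorm (edge_vec V i) * \int[@lebesgue_measure R]_(t in `[0, 1]) w.[t].
Proof.
move=> fw; congr (_ * _); apply: eq_Rintegral => t; rewrite inE /= in_itv; exact: fw.
Qed.

Lemma eq_edge_integral i f g : (forall x, edge V i x -> f x = g x) ->
  edge_integral V i f = edge_integral V i g.
Proof.
move=> fg; congr (_ * _); apply: eq_Rintegral => t; rewrite inE /= in_itv => t01.
by rewrite fg //; exact: edge_pointP.
Qed.

Lemma edge_integralD i f g : edge_poly i f -> edge_poly i g ->
  edge_integral V i (fun x => f x + g x) = edge_integral V i f + edge_integral V i g.
Proof.
move=> [u fu] [w gw]; rewrite (edge_integralE fu) (edge_integralE gw) -mulrDr.
rewrite (@edge_integralE _ _ (u + w)) => [|t t01]; last by rewrite hornerD fu ?gw.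
congr (_ * _); rewrite -RintegralD //; try exact: poly_integrable.
by apply: eq_Rintegral => t _; rewrite hornerD.
Qed.

Lemma edge_integralZ i f (a : R) : edge_poly i f ->
  edge_integral V i (fun x => a * f x) = a * edge_integral V i f.
Proof.
move=> [u fu]; rewrite (edge_integralE fu) mulrCA.
rewrite (@edge_integralE _ _ (a *: u)) => [|t t01]; last by rewrite hornerZ fu.
congr (_ * _); rewrite -RintegralZl //; try exact: poly_integrable.
by apply: eq_Rintegral => t _; rewrite hornerZ.
Qed.

Lemma edge_vec_neq0 i : edge_vec V i != 0.
Proof.
rewrite /edge_vec subr_eq0; apply/eqP => e.
have := bary_vertex (i - 1) (i + 1) hV; rewrite -e bary_vertex // eqxx ord3_neq.
by move/eqP; rewrite oner_eq0.
Qed.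

(** The edge has positive length, so the integral over the unit interval vanishes. *)
Lemma edge_integral_eq0 i f (w : {poly R}) :
  (forall t, 0 <= t <= 1 -> f (edge_point V i t) = w.[t]) ->
  (forall t, 0 <= t <= 1 -> 0 <= w.[t]) -> edge_integral V i f = 0 -> w = 0.
Proof.
move=> fw w0; rewrite (edge_integralE fw) => /eqP; rewrite mulf_eq0.
rewrite (gt_eqF (enorm_gt0 (edge_vec_neq0 i))) => /eqP; exact: poly_eq0_Rintegral.
Qed.

(** The loss of one degree matters: the normal derivative is tested with polynomials
    of degree k - 1, two less than its own degree k + 1. *)
Lemma polyfun_derive n f d : polyfun n f -> polyfun n.-1 (fun x => 'D_d f x).
Proof.
elim: n f => [f /funext -> x|n ih f [c [g [h [pg ph /funext ->]]]]]; first exact: derive_cst.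
have a1 : affine (fun x : R * R => x.1) by exists 1, 0, 0 => x; ring.
have a2 : affine (fun x : R * R => x.2) by exists 0, 1, 0 => x; ring.
have E : forall x, 'D_d (fun x => c + x.1 * g x + x.2 * h x) x =
    (d.1 * g x + x.1 * 'D_d g x) + (d.2 * h x + x.2 * 'D_d h x).
  move=> x; have dg := diff_derivable (v := d) (differentiable_polyfun x pg).
  have dh := diff_derivable (v := d) (differentiable_polyfun x ph).
  have d1 := diff_derivable (v := d) (differentiable_polyfun x (affine_polyfun a1)).
  have d2 := diff_derivable (v := d) (differentiable_polyfun x (affine_polyfun a2)).
  have D1 : 'D_d (fun x : R * R => x.1) x = d.1.
    have fw (s : R) : (x + s *: d).1 = (d.1 *: 'X + x.1%:P).[s].
      by rewrite !hornerE /= /GRing.scale /= addrC mulrC.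
    have := @derive_along R (fun x => x.1) x d _ 0 fw.
    by rewrite scale0r addr0 derivD derivZ derivX derivC addr0 alg_polyC hornerC.
  have D2 : 'D_d (fun x : R * R => x.2) x = d.2.
    have fw (s : R) : (x + s *: d).2 = (d.2 *: 'X + x.2%:P).[s].
      by rewrite !hornerE /= /GRing.scale /= addrC mulrC.
    have := @derive_along R (fun x => x.2) x d _ 0 fw.
    by rewrite scale0r addr0 derivD derivZ derivX derivC addr0 alg_polyC hornerC.
  have dg1 := derivableM d1 dg; have dh2 := derivableM d2 dh.
  have dc := @derivable_cst R _ _ c x d.
  have -> : (fun x => c + x.1 * g x + x.2 * h x) =
    cst c + (fun x => x.1) * g + (fun x => x.2) * h by [].
  rewrite (deriveD (derivableD dc dg1) dh2) (deriveD dc dg1) derive_cst.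
  rewrite (deriveM d1 dg) (deriveM d2 dh) D1 D2 /GRing.scale /=; ring.
apply: (eq_polyfun E) => /=.
have M e f' : affine e -> polyfun n f' -> polyfun n (fun x => e x * 'D_d f' x).
  case: n {pg ph} ih => [|n] ih al pf'.
    by move=> x; rewrite (ih _ pf' x) mulr0.
  by apply: (polyfunM_affine al); exact: ih pf'.
by apply: polyfunD; apply: polyfunD; [exact: polyfunZ|exact: M|exact: polyfunZ|exact: M].
Qed.
End EdgeIntegrals.

(** * Vanishing on the edges *)

Section PolyRoots.
Variable R : realType.
Implicit Types (w u r : {poly R}) (a : R).

Lemma poly_root w a : w.[a] = 0 ->
  exists2 q, w = q * ('X - a%:P) & (size q <= (size w).-1)%N.
Proof.
move=> /eqP /factor_theorem[q wE]; exists q => //.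
have [->|q0] := eqVneq q 0; first by rewrite size_poly0.
by rewrite wE size_Mmonic ?monicXsubC // size_XsubC addn2.
Qed.

Lemma poly_double_root w a : w.[a] = 0 -> w^`().[a] = 0 ->
  exists2 q, w = q * ('X - a%:P) ^+ 2 & (size q <= (size w).-2)%N.
Proof.
move=> /poly_root[q wE sq] h.
have /poly_root[r qE sr] : q.[a] = 0.
  move: h; rewrite wE derivM derivB derivX derivC subr0 mulr1 hornerD hornerM.
  by rewrite hornerXsubC subrr mulr0 add0r.
exists r; first by rewrite wE qE -mulrA -expr2.
by apply: leq_trans sr _; rewrite -!subn1 leq_sub2r // subn1.
Qed.
End PolyRoots.

Section EdgeVanishing.
Variables (R : realType) (V : 'I_3 -> R * R).
Hypothesis hV : nondegenerate_triangle V.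
Implicit Types (f g v : R * R -> R) (x : R * R) (i : 'I_3).

Lemma edge_integral_sum i (I : Type) (s : seq I) (F : I -> R * R -> R) :
  (forall z, edge_poly V i (F z)) ->
  edge_poly V i (fun x => \sum_(z <- s) F z x) /\
  edge_integral V i (fun x => \sum_(z <- s) F z x) =
    \sum_(z <- s) edge_integral V i (F z).
Proof.
move=> pF; elim: s => [|z s [ih1 ih2]].
  have -> : (fun x => \sum_(z <- [::]) F z x) = fun=> 0.
    by apply/funext => x; rewrite big_nil.
  have p0 : edge_poly V i (fun=> 0) by exists 0 => t _; rewrite horner0.
  split=> //; rewrite big_nil -[RHS](mul0r (edge_integral V i (fun=> 0))).
  by rewrite -edge_integralZ //; congr edge_integral; apply/funext => x; rewrite mul0r.
have -> : (fun x => \sum_(y <- z :: s) F y x) = fun x => F z x + \sum_(y <- s) F y x.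
  by apply/funext => x; rewrite big_cons.
by split; [exact: edge_polyD|rewrite edge_integralD // big_cons ih2].
Qed.

Lemma polyOn_edge_poly i m f : polyOn m (edge V i) f -> edge_poly V i f.
Proof.
case/(@polyOn_polyfun _ _ `|m|.+1) => [d dm|g pg fg].
  by rewrite ltnS -lez_nat (le_trans dm) // lez_abs.
by apply: eq_edge_poly fg _; exact: polyfun_edge_poly pg.
Qed.

(** Vanishing moments against a basis give vanishing moments against the whole
    space, in particular against the cofactor of v itself. *)
Lemma edge_moment_eq0 i m n (q : 'I_n -> R * R -> R) v f :
  is_basis (edge V i) (polyOn m (edge V i)) q -> edge_poly V i v ->
  (forall j, edge_integral V i (fun x => v x * q j x) = 0) ->
  polyOn m (edge V i) f -> edge_integral V i (fun x => v x * f x) = 0.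
Proof.
move=> [Wq /(_ f)bU] pv vq /bU[c [fE _]].
rewrite (@eq_edge_integral _ _ i _ (fun x => \sum_j c j * (v x * q j x))); last first.
  by move=> x xe; rewrite fE // mulr_sumr; apply: eq_bigr => j _; rewrite mulrCA.
have pvq j : edge_poly V i (fun x => v x * q j x).
  by apply: edge_polyM => //; exact: polyOn_edge_poly (Wq j).
rewrite (edge_integral_sum _ (fun j => edge_polyZ (c j) (pvq j))).2 big1 // => j _.
by rewrite edge_integralZ // vq mulr0.
Qed.

Lemma poly_affine_polyfun n (r : {poly R}) f : affine f -> (size r <= n)%N ->
  polyfun n (fun x => r.[f x]).
Proof.
move=> af sr.
have -> : (fun x => r.[f x]) = fun x => \sum_(j < n) r`_j * f x ^+ j.
  by apply/funext => x; rewrite (horner_coef_wide _ sr).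
apply: polyfun_sum => j _; apply: polyfunZ.
have := polyfunM_affineX j af (polyfun_cst 0 (1 : R)).
rewrite addn1 => /(polyfun_le (ltn_ord j)); apply: eq_polyfun => x; ring.
Qed.

(** Test functions on the edge are written as polynomials in the barycentric
    coordinate that restricts to the edge parameter. *)
Definition moment_free n i v := forall r : {poly R}, (size r <= n)%N ->
  edge_integral V i (fun x => v x * r.[bary V (i - 1) x]) = 0.

(** Double roots at both endpoints give w = t^2 (t-1)^2 r with deg r small enough
    to be a test function, and w r is nonnegative. *)
Lemma moment_free_hermite n i v (w : {poly R}) :
  (forall t, 0 <= t <= 1 -> v (edge_point V i t) = w.[t]) ->
  (size w <= n.+4)%N -> moment_free n i v ->
  w.[0] = 0 -> w.[1] = 0 -> w^`().[0] = 0 -> w^`().[1] = 0 -> w = 0.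
Proof.
move=> vw sw mv w0 w1 dw0 dw1.
have [q wE sq] := poly_double_root w0 dw0.
have q1 : q.[1] = 0 by move: w1; rewrite wE !hornerE /= subr0 ?expr1n ?mulr1.
have dq1 : q^`().[1] = 0.
  by move: dw1; rewrite wE derivM hornerD !hornerM q1 mul0r addr0 !hornerE /= subr0 ?expr1n ?mulr1.
have [r qE sr] := poly_double_root q1 dq1.
have sn : (size r <= n)%N.
  apply: leq_trans sr _; rewrite -!subn1 !leq_subLR !add1n.
  by apply: leq_trans sq _; rewrite -!subn1 !leq_subLR !add1n.
have wrt t : w.[t] * r.[t] = (t * (t - 1) * r.[t]) ^+ 2.
  by rewrite wE qE !hornerE /=; ring.
have wr : w * r = 0.
  apply: (edge_integral_eq0 hV _ _ (mv r sn)) => t t01.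
    by rewrite hornerM vw //; have [_ -> _] := bary_edge hV i t.
  by rewrite hornerM wrt sqr_ge0.
by move/eqP: wr; rewrite mulf_eq0 => /orP[/eqP //|/eqP r0]; rewrite wE qE r0 !mul0r.
Qed.

(** Simple roots give w = t (t-1) r; testing with -r makes the integrand nonnegative
    on the unit interval. *)
Lemma moment_free_lagrange n i v (w : {poly R}) :
  (forall t, 0 <= t <= 1 -> v (edge_point V i t) = w.[t]) ->
  (size w <= n.+2)%N -> moment_free n i v -> w.[0] = 0 -> w.[1] = 0 -> w = 0.
Proof.
move=> vw sw mv w0 w1.
have [q wE sq] := poly_root w0.
have /poly_root[r qE sr] : q.[1] = 0.
  by move: w1; rewrite wE !hornerE /= subr0 ?mulr1.
have sn : (size (- r) <= n)%N.
  rewrite size_polyN; apply: leq_trans sr _; rewrite -!subn1 !leq_subLR !add1n.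
  by apply: leq_trans sq _; rewrite -!subn1 !leq_subLR !add1n.
have wrt t : w.[t] * (- r).[t] = t * (1 - t) * r.[t] ^+ 2.
  by rewrite wE qE !hornerE /=; ring.
have wr : w * (- r) = 0.
  apply: (edge_integral_eq0 hV _ _ (mv _ sn)) => t t01.
    by rewrite hornerM vw //; have [_ -> _] := bary_edge hV i t.
  have /andP[t0 t1] := t01.
  by rewrite hornerM wrt mulr_ge0 ?sqr_ge0 // mulr_ge0 ?subr_ge0.
move/eqP: wr; rewrite mulf_eq0 oppr_eq0 => /orP[/eqP //|/eqP r0].
by rewrite wE qE r0 !mul0r.
Qed.

(** A unit normal and the edge vector form a basis of the plane. *)
Lemma normal_tangent_eq0 i (n w : R * R) : is_unit_normal V i n ->
  dot w n = 0 -> dot w (edge_vec V i) = 0 -> w = 0.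
Proof.
move=> [n1 ne] wn we.
have nn : dot n n = 1.
  have n0 : 0 <= dot n n by rewrite /dot -!expr2 addr_ge0 // sqr_ge0.
  by rewrite -[LHS](sqr_sqrtr n0) -/(enorm n) n1 expr1n.
have e0 := edge_vec_neq0 hV i.
case: (edge_vec V i) e0 ne we => [e1 e2] e0.
case: n n1 nn wn => [p1 p2] _; case: w => [w1 w2]; rewrite /dot /= => pp wp pe we.
(* beta and gamma are the coordinates of w and e along the rotated normal *)
pose beta := w2 * p1 - w1 * p2; pose gamma := e2 * p1 - e1 * p2.
have coord z1 z2 : z1 = (z1 * p1 + z2 * p2) * p1 - (z2 * p1 - z1 * p2) * p2 /\
    z2 = (z1 * p1 + z2 * p2) * p2 + (z2 * p1 - z1 * p2) * p1.
  by split; [rewrite -[LHS]mulr1 -pp|rewrite -[LHS]mulr1 -pp]; ring.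
have ep : e1 * p1 + e2 * p2 = 0 by rewrite -pe; ring.
have : beta * gamma = 0.
  transitivity ((w1 * e1 + w2 * e2) * (p1 * p1 + p2 * p2)
      - (w1 * p1 + w2 * p2) * (e1 * p1 + e2 * p2)); first by rewrite /beta /gamma; ring.
  by rewrite we wp ep !mul0r subrr.
move/eqP; rewrite mulf_eq0 => /orP[] /eqP b0.
  have [h1 h2] := coord w1 w2; rewrite -/beta wp b0 !mul0r ?subrr ?addr0 in h1 h2.
  by rewrite h1 h2.
have [h1 h2] := coord e1 e2; rewrite -/gamma ep b0 !mul0r ?subrr ?addr0 in h1 h2.
by move: e0; rewrite h1 h2 eqxx.
Qed.

End EdgeVanishing.

(** * Division by squares of barycentric coordinates *)

Section DoubleDivision.
Variables (R : realType) (V : 'I_3 -> R * R).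
Hypothesis hV : nondegenerate_triangle V.
Implicit Types (f g h : R * R -> R) (x d : R * R) (i j l : 'I_3).

(** After one division f = l_i g, the derivative of f transversal to the edge is g on
    the edge, so g is divisible again. *)
Lemma polyfun_div_bary2 n i f : polyfun n f -> (forall t, f (edge_point V i t) = 0) ->
  (forall t d, 'D_d f (edge_point V i t) = 0) ->
  exists2 g, polyfun n.-2 g & forall x, f x = bary V i x ^+ 2 * g x.
Proof.
move=> pf f0 df0; have [g pg fE] := polyfun_div_bary hV pf f0.
have [t|h ph gE] := polyfun_div_bary hV (i := i) pg; last first.
  by exists h => // x; rewrite fE gE expr2 mulrA.
set x := edge_point V i t; pose d := V i - V (i + 1).
have [u _ uE] := polyfun_line x d pg.
have fu s : f (x + s *: d) = ('X * u).[s].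
  rewrite fE uE hornerM hornerX; congr (_ * _).
  by have [] := bary_chart hV i (t, s).
have := derive_along 0 fu; rewrite scale0r addr0 df0 derivM derivX mul1r.
by rewrite hornerD hornerM hornerX mul0r addr0 -uE scale0r addr0.
Qed.

(** Cancellation is immediate in the interior, where l_j > 0, and polynomial functions
    that agree there agree everywhere. *)
Lemma polyfun_cancel_bary j n m f g : polyfun n f -> polyfun m g ->
  (forall x, bary V j x * f x = bary V j x * g x) -> forall x, f x = g x.
Proof.
move=> pf pg fg x; apply/eqP; rewrite -subr_eq0; apply/eqP; move: x.
have pm : polyfun (n + m) (fun x => f x - g x).
  by apply: polyfunB; [apply: polyfun_le pf; exact: leq_addr|apply: polyfun_le pg; exact: leq_addl].
apply: (polyfun_eq0_interior hV pm) => x /(_ j) xj.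
by apply: (mulfI (lt0r_neq0 xj)); rewrite mulrBr fg subrr mulr0.
Qed.

Lemma polyfun_div_coprime2 i j n m f g : i != j -> polyfun n f -> polyfun m g ->
  (forall x, bary V i x ^+ 2 * f x = bary V j x ^+ 2 * g x) ->
  exists2 h, polyfun n.-2 h & forall x, f x = bary V j x ^+ 2 * h x.
Proof.
move=> ij pf pg fg.
have pif := polyfunM_affine (bary_is_affine V i) pf.
have pjg := polyfunM_affine (bary_is_affine V j) pg.
have [x|f1 pf1 f1E] := polyfun_div_coprime hV ij pif (g := fun x => bary V j x * g x).
  have := fg x; rewrite !expr2 -!mulrA; exact.
have [f2 pf2 f2E] := polyfun_div_coprime hV ij pf f1E.
have pif2 := polyfunM_affine (bary_is_affine V i) pf2.
have piif2 := polyfunM_affine (bary_is_affine V i) pif2.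
have h1 : forall x, bary V i x * (bary V i x * f2 x) = bary V j x * g x.
  apply: (polyfun_cancel_bary (j := j) piif2 pjg) => x.
  by transitivity (bary V i x ^+ 2 * f x); [rewrite f2E|rewrite fg]; ring.
have [f3 pf3 f3E] := polyfun_div_coprime hV ij pif2 h1.
have [f4 pf4 f4E] := polyfun_div_coprime hV ij pf2 f3E.
by exists f4 => // x; rewrite f2E f4E expr2 mulrA.
Qed.
End DoubleDivision.

(** * Vanishing of the enrichment coefficients *)

Section EnrichmentCoefficients.
Variables (R : realType) (V : 'I_3 -> R * R) (k : nat).
Hypotheses (hV : nondegenerate_triangle V) (hk : (2 <= k)%N).
Implicit Types (f g h p : R * R -> R) (x d : R * R) (i j l : 'I_3).

(** In the coordinates x = l_(l+1), y = l_(l-1) at vertex l, compare the two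
    expressions of P_(l+1) - P_(l-1) on the lines x = y and x = -y through the vertex.
    On the first line the enrichment cancels, which gives A_(l+1) = A_(l-1) at the
    vertex.  On the second one, dividing by the square of the parameter and passing
    to the vertex leaves 4 C (k+1) c_l = A_(l+1) - A_(l-1) = 0.  The coefficients of
    the two other enrichment functions drop out because k + 1 >= 3. *)
Lemma enrichment_coef_eq0 n p (cf : 'I_3 -> R) (A : 'I_3 -> R * R -> R) :
  (forall l, polyfun n (A l)) ->
  (forall l x, p x + \sum_i cf i * enrichment_piece V k i l x = bary V l x ^+ 2 * A l x) ->
  forall l, cf l = 0.
Proof.
move=> pA pE l; pose C := enrichment_cst V k.
pose B := fun x => A (l + 1) x - A (l - 1) x.
have pB : polyfun n B by exact: polyfunB.
pose a := V (l + 1) - V l; pose b := V (l - 1) - V l.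
have lineE s t : chart V (l - 1) (s, t) = V l + (s *: a + t *: b).
  by rewrite /chart /edge_point /edge_vec !ord3_shift /= -addrA.
have lineB s t : [/\ bary V (l + 1) (V l + (s *: a + t *: b)) = s,
    bary V (l - 1) (V l + (s *: a + t *: b)) = t
  & bary V l (V l + (s *: a + t *: b)) = 1 - s - t].
  by rewrite -lineE; have := bary_chart hV (l - 1) (s, t); rewrite !ord3_shift => -[-> -> ->].
have diffE x : bary V (l + 1) x ^+ 2 * A (l + 1) x - bary V (l - 1) x ^+ 2 * A (l - 1) x =
  \sum_i cf i * (enrichment_piece V k i (l + 1) x - enrichment_piece V k i (l - 1) x).
  rewrite -!pE opprD addrACA subrr add0r -sumrB; apply: eq_bigr => i _.
  by rewrite mulrBr.
(* p cancels, and so does the piece of each enrichment function on the subtriangle of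
   the same index, which is zero. *)
have diff3 x : bary V (l + 1) x ^+ 2 * A (l + 1) x - bary V (l - 1) x ^+ 2 * A (l - 1) x =
  C * (cf l * ((bary V l x - bary V (l + 1) x) ^+ k.+1 - (bary V l x - bary V (l - 1) x) ^+ k.+1)
         * (bary V (l - 1) x - bary V (l + 1) x)
     - cf (l + 1) * (bary V (l + 1) x - bary V (l - 1) x) ^+ k.+1
         * (bary V l x - bary V (l - 1) x)
     + cf (l - 1) * (bary V (l - 1) x - bary V (l + 1) x) ^+ k.+1
         * (bary V (l + 1) x - bary V l x)).
  rewrite diffE (sum_cyc _ l) /enrichment_piece !ord3_shift -/C !subrr.
  by rewrite !exprS !mul0r; ring.
(* On the line x = y the right-hand side of [diff3] is zero. *)
have B0 : B (V l) = 0.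
  have [w _ wE] := polyfun_line (V l) (a + b) pB.
  have w0 : w = 0.
    have : 'X ^+ 2 * w = 0.
      apply: (@poly_eq0_near _ _ 1) => // t _; rewrite hornerM hornerXn -wE.
      have := diff3 (V l + t *: (a + b)); rewrite scalerDr.
      have [-> -> ->] := lineB t t; rewrite -mulrBr -/(B _) => ->.
      by rewrite !subrr !exprS; ring.
    by move/eqP; rewrite mulf_eq0 expf_eq0 polyX_eq0 /= => /eqP.
  by move: (wE 0); rewrite w0 horner0 scale0r addr0.
have [w _ wE] := polyfun_line (V l) (a - b) pB.
have w0 : w.[0] = 0 by rewrite -wE scale0r addr0.
(* S is the quotient of (1 + t)^(k+1) - (1 - t)^(k+1) by 2 t; its value at 0 is k + 1.
   Q is the difference of the two sides of [diff3], divided by t^2, on the line x = t, y = - t. *)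
pose S : {poly R} := \sum_(i < k.+1) (1 + 'X) ^+ (k.+1.-1 - i) * (1 - 'X) ^+ i.
pose Q : {poly R} := C%:P * ((4 * cf l)%:P * S
  - (cf (l + 1) * 2 ^+ k.+1)%:P * 'X^(k.-1) * (1 + 'X)
  - (cf (l - 1) * (- 2) ^+ k.+1)%:P * 'X^(k.-1) * (1 - 'X)) - w.
have Q0 : Q = 0.
  have : 'X ^+ 2 * Q = 0.
    apply: (@poly_eq0_near _ _ 1) => // t _.
    have := diff3 (V l + t *: (a - b)); rewrite scalerBr -scaleNr.
    have [-> -> ->] := lineB t (- t); rewrite scaleNr -scalerBr.
    rewrite sqrrN -mulrBr -/(B _) wE => h.
    rewrite hornerM hornerXn /Q hornerD hornerN mulrDr mulrN h.
    have SE : (1 + t) ^+ k.+1 - (1 - t) ^+ k.+1 = 2 * t * S.[t].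
      rewrite subrXX /S horner_sum (_ : 1 + t - (1 - t) = 2 * t); last by ring.
      by congr (_ * _); apply: eq_bigr => i _; rewrite !hornerE.
    have e1 : 1 - t - - t - t = 1 - t by ring.
    have e2 : 1 - t - - t - - t = 1 + t by ring.
    rewrite e1 e2.
    have -> : (1 - t) ^+ k.+1 - (1 + t) ^+ k.+1 = - (2 * t * S.[t]) by rewrite -SE opprB.
    have -> : t - - t = 2 * t by ring.
    have -> : - t - t = - 2 * t by ring.
    have -> : 1 - t - - t = 1 by ring.
    rewrite !exprMn.
    have -> : t ^+ k.+1 = t ^+ 2 * t ^+ k.-1.
      by rewrite -exprD addSn add1n prednK // (ltn_trans _ hk).
    rewrite !(hornerM, hornerD, hornerN, hornerC, hornerXn, hornerX).
    ring.
  by move/eqP; rewrite mulf_eq0 expf_eq0 polyX_eq0 /= => /eqP.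
have S0 : S.[0] = k.+1%:R.
  rewrite /S horner_sum (eq_bigr (fun=> 1)) ?sumr_const ?card_ord // => i _.
  by rewrite !hornerE /= ?subr0 ?addr0 !expr1n ?mulr1.
have k1 : (0 < k.-1)%N by rewrite -ltnS prednK // (ltn_trans _ hk).
have : Q.[0] = 0 by rewrite Q0 horner0.
rewrite /Q !(hornerM, hornerD, hornerN, hornerC, hornerXn, hornerX) w0 S0.
rewrite expr0n gtn_eqF // !mulr0 !mul0r !subr0 => /eqP.
have C0 : C != 0 := enrichment_cst_neq0 k hV.
rewrite mulf_eq0 (negPf C0) !mulf_eq0 !pnatr_eq0 orbF /=.
by move/eqP.
Qed.
End EnrichmentCoefficients.

(** * Uniqueness *)

Section Uniqueness.
Variables (R : realType) (V : 'I_3 -> R * R) (k : nat).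
Hypotheses (hV : nondegenerate_triangle V) (hk : (2 <= k)%N).
Variable nrm : 'I_3 -> R * R.
Hypothesis hnrm : forall i, is_unit_normal V i (nrm i).
Variables (a b c : nat) (qa : 'I_3 -> 'I_a -> R * R -> R).
Hypothesis hqa : forall i, is_basis (edge V i) (polyOn (k%:Z - 2) (edge V i)) (qa i).
Variable qb : 'I_3 -> 'I_b -> R * R -> R.
Hypothesis hqb : forall i, is_basis (edge V i) (polyOn (k%:Z - 1) (edge V i)) (qb i).
Variable qc : 'I_c -> R * R -> R.
Hypothesis hqc : is_basis (hull V) (polyOn (k%:Z - 4) (hull V)) qc.
Implicit Types (v p : R * R -> R) (x d : R * R) (i l : 'I_3).

(** The vertex values and gradients supply the endpoint conditions of
    [moment_free_hermite] and [moment_free_lagrange]; values and normal derivative on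
    the edge then determine the gradient. *)
Lemma dof_eq0_edge v P : traces V k.+3 v P ->
  (forall J, dof V nrm qa qb qc J v = 0) ->
  forall i t, P i (edge_point V i t) = 0 /\ forall d, 'D_d (P i) (edge_point V i t) = 0.
Proof.
move=> tvP v0 i; have [pP vP] := tvP.
have dP x d : dot (gradf (P i) x) d = 'D_d (P i) x.
  by apply: dot_gradf; exact: differentiable_polyfun (pP i).
have vV j : v (V j) = 0 := v0 (VertexValue _ _ _ j).
have gV j : gradient (hull V) v (V j) = 0.
  have := v0 (VertexD1 _ _ _ j); have := v0 (VertexD2 _ _ _ j) => /=.
  by case: (gradient _ _ _) => g1 g2 /= -> ->.
have t0 : 0 <= (0 : R) <= 1 by rewrite lexx ler01.
have t1 : 0 <= (1 : R) <= 1 by rewrite lexx ler01.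
have gP0 : gradf (P i) (edge_point V i 0) = 0.
  by rewrite -(traces_gradient hV _ tvP t0) edge_point0 gV.
have gP1 : gradf (P i) (edge_point V i 1) = 0.
  by rewrite -(traces_gradient hV _ tvP t1) edge_point1 gV.
have dot0 d : dot (0 : R * R) d = 0 by rewrite /dot /= !mul0r addr0.
have k0 : (0 < k)%N by exact: ltn_trans hk.
have [w sw wE] := polyfun_line (V (i + 1)) (edge_vec V i) (pP i).
have dw t : w^`().[t] = dot (gradf (P i) (edge_point V i t)) (edge_vec V i).
  by rewrite dP /edge_point (derive_along t wE).
have vw t : 0 <= t <= 1 -> v (edge_point V i t) = w.[t].
  by move=> t01; rewrite (vP i t t01).1 -wE.
have w0 : w = 0.
  apply: (moment_free_hermite hV (n := k.-1) vw).
  - by rewrite prednK.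
  - move=> r sr; apply: (edge_moment_eq0 (hqa i)); first by exists w.
      by move=> j; exact: (v0 (EdgeMoment _ _ i j)).
    apply: (polyfun_polyOn (n := k.-1)); first by move=> n nk; lia.
    by apply: poly_affine_polyfun => //; exact: bary_is_affine.
  - by rewrite -vw // edge_point0.
  - by rewrite -vw // edge_point1.
  - by rewrite dw gP0 dot0.
  - by rewrite dw gP1 dot0.
have [u su uE] := polyfun_line (V (i + 1)) (edge_vec V i) (polyfun_derive (nrm i) (pP i)).
have nu t : 0 <= t <= 1 ->
    dot (gradient (hull V) v (edge_point V i t)) (nrm i) = u.[t].
  by move=> t01; rewrite (traces_gradient hV _ tvP t01) dP -uE.
have u0 : u = 0.
  apply: (moment_free_lagrange hV (n := k)
    (v := fun x => dot (gradient (hull V) v x) (nrm i)) nu) => //.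
  - move=> r sr; apply: (edge_moment_eq0 (hqb i)); first by exists u.
      by move=> j; exact: (v0 (EdgeNormalMoment _ _ i j)).
    apply: (polyfun_polyOn (n := k)); first by move=> n nk; lia.
    by apply: poly_affine_polyfun => //; exact: bary_is_affine.
  - by rewrite -nu // edge_point0 gV dot0.
  - by rewrite -nu // edge_point1 gV dot0.
move=> t; split; first by rewrite /edge_point wE w0 horner0.
suff g0 : gradf (P i) (edge_point V i t) = 0 by move=> d; rewrite -dP g0 dot0.
apply: (normal_tangent_eq0 hV (hnrm i)).
  by rewrite dP /edge_point uE u0 horner0.
by rewrite -dw w0 deriv0 horner0.
Qed.

(** The quotient r of p by l_0^2 l_1^2 l_2^2 has degree at most k - 4, hence is a
    combination of the test functions, and p r is a square. *)
Lemma dof_eq0_interior p : polyfun k.+3 p ->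
  (forall i t, p (edge_point V i t) = 0 /\ forall d, 'D_d p (edge_point V i t) = 0) ->
  (forall j, \int[@plane_measure R]_(x in hull V) (p x * qc j x) = 0) ->
  forall x, p x = 0.
Proof.
move=> pp p0 pq.
have pA i : exists2 A, polyfun k.+1 A & forall x, p x = bary V i x ^+ 2 * A x.
  by apply: (polyfun_div_bary2 hV pp) => t; have [] := p0 i t.
have [[A0 p0' E0] [A1 p1 E1] [A2 p2 E2]] := And3 (pA 0) (pA 1) (pA (-1)).
have [x|h ph A0E] := polyfun_div_coprime2 hV (i := 0) (j := 1) isT p0' p1.
  by rewrite -E0 -E1.
have ph' := polyfunM_affineX 2 (bary_is_affine V 1) ph.
have [x|h' ph2 hE'] := polyfun_div_coprime2 hV (i := 0) (j := -1) isT ph' p2.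
  by rewrite -E2 E0 A0E.
have [r pr hE] := polyfun_div_coprime2 hV (i := 1) (j := -1) isT ph ph2 hE'.
have pE x : p x = (bary V 0 x * bary V 1 x * bary V (-1) x) ^+ 2 * r x.
  by rewrite E0 A0E hE; ring.
have pr4 : polyOn (k%:Z - 4) (hull V) r.
  by apply: (polyfun_polyOn _ _ pr) => n nk; lia.
have [Wq /(_ _ pr4)[cf [rE _]]] := hqc.
have tp : meas_cont p by exact: meas_cont_polyfun pp.
have tr : meas_cont r by exact: meas_cont_polyfun pr.
have Iq j : (@plane_measure R).-integrable (hull V) (EFin \o (fun x => p x * qc j x)).
  have [g pg gE] : exists2 g, polyfun `|k%:Z - 4|.+1 g & forall x, hull V x -> qc j x = g x.
    by apply: polyOn_polyfun (Wq j) => n nk; lia.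
  have := hull_integrable hV (meas_contM tp (meas_cont_polyfun pg)).
  by apply: eq_integrable; [exact: measurable_hull|move=> x /set_mem Tx /=; rewrite gE].
have Ipr : \int[@plane_measure R]_(x in hull V) (p x * r x) = 0.
  have -> : \int[@plane_measure R]_(x in hull V) (p x * r x) =
      \int[@plane_measure R]_(x in hull V) (\sum_j cf j * (p x * qc j x)).
    apply: eq_Rintegral => x /set_mem Tx; rewrite rE // mulr_sumr.
    by apply: eq_bigr => j _; rewrite mulrCA.
  have Icq j : (@plane_measure R).-integrable (hull V)
      (EFin \o (fun x => cf j * (p x * qc j x))).
    by apply: integrableZl (Iq j); exact: measurable_hull.
  have [|_ ->] := Rintegral_sum (index_enum 'I_c) _ Icq; first exact: measurable_hull.
  rewrite big1 // => j _; rewrite RintegralZl; [|exact: measurable_hull|exact: Iq].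
  by rewrite pq mulr0.
have pr0 x : (forall i, 0 < bary V i x) -> r x = 0.
  have prE y : p y * r y = (bary V 0 y * bary V 1 y * bary V (-1) y * r y) ^+ 2.
    by rewrite pE; ring.
  have pr_ge0 y : hull V y -> 0 <= p y * r y by rewrite prE sqr_ge0.
  move=> x0; have /eqP := Rintegral_hull_eq0 hV (meas_contM tp tr) pr_ge0 Ipr x0.
  have n0 := lt0r_neq0 (mulr_gt0 (mulr_gt0 (x0 0) (x0 1)) (x0 (-1))).
  by rewrite prE sqrf_eq0 mulf_eq0 (negPf n0) => /eqP.
have r0 := polyfun_eq0_interior hV pr pr0.
by move=> x; rewrite pE r0 mulr0.
Qed.
End Uniqueness.

(** * Linearity of the degrees of freedom *)

Section DofLinearity.
Variables (R : realType) (V : 'I_3 -> R * R).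
Hypothesis hV : nondegenerate_triangle V.
Implicit Types (f g v w : R * R -> R) (x d : R * R) (i l : 'I_3).

Lemma gradient_comb (I : Type) (s : seq I) (u : I -> R) (g : I -> R * R -> R) x :
  hull V x -> (forall z, exists d, is_gradient (hull V) (g z) x d) ->
  gradient (hull V) (fun y => \sum_(z <- s) u z * g z y) x =
  \sum_(z <- s) u z *: gradient (hull V) (g z) x.
Proof.
move=> Tx gz; apply: gradient_val => //.
have {}gz z : is_gradient (hull V) (g z) x (gradient (hull V) (g z) x).
  by have [d hd] := gz z; rewrite (gradient_val hV Tx hd).
elim: s => [|z s ih].
  rewrite big_nil (_ : (fun y => _) = fun=> 0); first exact: is_gradient0.
  by apply/funext => y; rewrite big_nil.
rewrite big_cons (_ : (fun y => _) = fun y => u z * g z y + \sum_(z <- s) u z * g z y).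
  by apply: is_gradientD ih; exact: is_gradientZ.
by apply/funext => y; rewrite big_cons.
Qed.

Variables (nrm : 'I_3 -> R * R) (a b c : nat).
Variables (ma mb mc : int) (qa : 'I_3 -> 'I_a -> R * R -> R).
Hypothesis hqa : forall i j, polyOn ma (edge V i) (qa i j).
Variable qb : 'I_3 -> 'I_b -> R * R -> R.
Hypothesis hqb : forall i j, polyOn mb (edge V i) (qb i j).
Variable qc : 'I_c -> R * R -> R.
Hypothesis hqc : forall j, polyOn mc (hull V) (qc j).

Lemma edge_sub_hull i x : edge V i x -> hull V x.
Proof. by move=> [t /=]; rewrite in_itv /= => t01 <-; exact: edge_hull. Qed.

Lemma eq_dof v w J : (forall x, hull V x -> v x = w x) ->
  dof V nrm qa qb qc J v = dof V nrm qa qb qc J w.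
Proof.
move=> vw; case: J => [i|i|i|i j|i j|j] /=.
- exact/vw/vertex_hull.
- by rewrite (eq_gradient (vertex_hull hV i) vw).
- by rewrite (eq_gradient (vertex_hull hV i) vw).
- by apply: eq_edge_integral => x /edge_sub_hull Tx; rewrite vw.
- by apply: eq_edge_integral => x /edge_sub_hull Tx; rewrite (eq_gradient Tx vw).
- by apply: eq_Rintegral => x /set_mem Tx; rewrite vw.
Qed.

Lemma polyOn_hull_polyfun m f : polyOn m (hull V) f ->
  exists2 g, polyfun `|m|.+1 g & forall x, hull V x -> f x = g x.
Proof. by apply: polyOn_polyfun => d dm; lia. Qed.

Lemma dof_comb n (I : Type) (s : seq I) (u : I -> R) (g : I -> R * R -> R) J :
  (forall z, admissible V n (g z)) ->
  dof V nrm qa qb qc J (fun x => \sum_(z <- s) u z * g z x) =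
  \sum_(z <- s) u z * dof V nrm qa qb qc J (g z).
Proof.
move=> sg.
have ge z i t : 0 <= t <= 1 -> exists d, is_gradient (hull V) (g z) (edge_point V i t) d.
  move=> t01; have [[P [_ gP]] _] := sg z.
  by exists (gradf (P i) (edge_point V i t)); have [] := gP i t t01.
have gV z i : exists d, is_gradient (hull V) (g z) (V i) d.
  have := ge z (i - 1) 0; rewrite edge_point0 ord3_shift; apply.
  by rewrite lexx ler01.
have pg z i : edge_poly V i (g z).
  have [[P [pP gP]] _] := sg z; have [w wE] := polyfun_edge_poly V i (pP i).
  by exists w => t t01; rewrite (gP i t t01).1 wE.
have pgn z i : edge_poly V i (fun x => dot (gradient (hull V) (g z) x) (nrm i)).
  have [[P tP] _] := sg z; have [pP gP] := tP.
  have [w wE] := polyfun_edge_poly V i (polyfun_derive (nrm i) (pP i)).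
  exists w => t t01; rewrite (traces_gradient hV _ tP t01) dot_gradf ?wE //.
  exact: differentiable_polyfun (pP i).
case: J => [i|i|i|i j|i j|j] /=.
- by [].
- rewrite gradient_comb; [|exact: vertex_hull|by move=> z; exact: gV].
  by elim: s => [|z s ih]; rewrite ?big_nil // !big_cons /= ih.
- rewrite gradient_comb; [|exact: vertex_hull|by move=> z; exact: gV].
  by elim: s => [|z s ih]; rewrite ?big_nil // !big_cons /= ih.
- have pz z : edge_poly V i (fun x => g z x * qa i j x).
    by apply: edge_polyM => //; exact: polyOn_edge_poly (hqa i j).
  rewrite (@eq_edge_integral _ _ i _ (fun x => \sum_(z <- s) u z * (g z x * qa i j x))).
    rewrite (edge_integral_sum s (fun z => edge_polyZ (u z) (pz z))).2.
    by apply: eq_bigr => z _; rewrite edge_integralZ.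
  by move=> x _; rewrite mulr_suml; apply: eq_bigr => z _; rewrite mulrA.
- have pz z : edge_poly V i (fun x => dot (gradient (hull V) (g z) x) (nrm i) * qb i j x).
    by apply: edge_polyM => //; exact: polyOn_edge_poly (hqb i j).
  rewrite (@eq_edge_integral _ _ i _ (fun x =>
     \sum_(z <- s) u z * (dot (gradient (hull V) (g z) x) (nrm i) * qb i j x))).
    rewrite (edge_integral_sum s (fun z => edge_polyZ (u z) (pz z))).2.
    by apply: eq_bigr => z _; rewrite edge_integralZ.
  move=> x [t /=]; rewrite in_itv /= => t01 <-.
  rewrite gradient_comb; [|exact: edge_hull|by move=> z; exact: ge].
  have -> : dot (\sum_(z <- s) u z *: gradient (hull V) (g z) (edge_point V i t)) (nrm i)
    = \sum_(z <- s) u z * dot (gradient (hull V) (g z) (edge_point V i t)) (nrm i).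
    elim: s => [|z s ih]; first by rewrite !big_nil /dot /= !mul0r addr0.
    by rewrite !big_cons dotDl dotZl ih.
  by rewrite mulr_suml; apply: eq_bigr => z _; rewrite mulrA.
- have iz z : (@plane_measure R).-integrable (hull V) (EFin \o (fun x => g z x * qc j x)).
    have [_ [F tF gF]] := sg z; have [q pq qE] := polyOn_hull_polyfun (hqc j).
    have := hull_integrable hV (meas_contM tF (meas_cont_polyfun pq)).
    apply: eq_integrable; first exact: measurable_hull.
    by move=> x /set_mem Tx /=; rewrite gF ?qE.
  have iuz z : (@plane_measure R).-integrable (hull V)
      (EFin \o (fun x => u z * (g z x * qc j x))).
    by apply: integrableZl (iz z); exact: measurable_hull.
  have [|_ sumE] := Rintegral_sum s _ iuz; first exact: measurable_hull.
  transitivity (\int[@plane_measure R]_(x in hull V)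
      (\sum_(z <- s) u z * (g z x * qc j x))).
    apply: eq_Rintegral => x _; rewrite mulr_suml; apply: eq_bigr => z _.
    by rewrite mulrA.
  rewrite sumE; apply: eq_bigr => z _.
  by rewrite RintegralZl //; exact: measurable_hull.
Qed.
End DofLinearity.

(** * Counting the degrees of freedom *)

Section Counting.
Variables (R : realType) (V : 'I_3 -> R * R).
Hypothesis hV : nondegenerate_triangle V.

Lemma polyOn0 m (D : set (R * R)) : polyOn m D (fun=> 0).
Proof. by apply: (polyfun_polyOn (n := 0)). Qed.

(** On an edge, polynomials of degree less than n are spanned by n powers of the edge
    parameter. *)
Lemma edge_basis_le i (m : int) n n' (q : 'I_n' -> R * R -> R) :
  (forall d : nat, d%:Z <= m -> (d < n)%N) ->
  is_basis (edge V i) (polyOn m (edge V i)) q -> (n' <= n)%N.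
Proof.
move=> mn bq; rewrite -[n]card_ord.
apply: (is_basis_le (g := fun (j : 'I_n) x => bary V (i - 1) x ^+ j) _ _ bq).
  exact: polyOn0.
move=> f /(polyOn_polyfun mn)[g pg fg].
have [w sw wE] := polyfun_line (V (i + 1)) (edge_vec V i) pg.
exists (fun j : 'I_n => w`_j) => x ex; rewrite fg //; case: ex => t _ <-.
have [_ -> _] := bary_edge hV i t.
by rewrite wE (horner_coef_wide _ sw).
Qed.

Lemma hull_basis_le (D : set (R * R)) (m : int) n n' (q : 'I_n' -> R * R -> R) :
  (forall d : nat, d%:Z <= m -> (d < n)%N) ->
  is_basis D (polyOn m D) q -> (n' <= #|monomialT n|)%N.
Proof.
move=> mn bq; apply: (is_basis_le (g := @monomial R n) _ _ bq); first exact: polyOn0.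
move=> f /(polyOn_polyfun mn)[g /monomial_span[u gE] fg].
by exists u => x Dx; rewrite fg.
Qed.

(** For k > 2 this compares the triangular numbers counting monomials of degree less
    than k + 3 and less than k - 3; k = 2 is separate because the difference k - 3 is
    truncated there. *)
Lemma dimension_count k a b c : (2 <= k)%N -> (a <= k.-1)%N -> (b <= k)%N ->
  (c <= #|monomialT (k - 3)|)%N ->
  (3 + (3 + (3 + (3 * a + (3 * b + c)))) <= #|monomialT k.+3| + 3)%N.
Proof.
case: k => [|[|[|k]]] // _.
  by rewrite !card_monomialT !card_monomialT0; lia.
by rewrite -addn3 addnK addn3 !card_monomialT; lia.
Qed.

(** The index type of the degrees of freedom as a finite type, so that they can be
    counted and used as columns of a matrix. *)
Definition dof_code a b c (J : dof_index a b c) :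
    'I_3 + ('I_3 + ('I_3 + ('I_3 * 'I_a + ('I_3 * 'I_b + 'I_c)))) :=
  match J with
  | VertexValue i => inl i
  | VertexD1 i => inr (inl i)
  | VertexD2 i => inr (inr (inl i))
  | EdgeMoment i j => inr (inr (inr (inl (i, j))))
  | EdgeNormalMoment i j => inr (inr (inr (inr (inl (i, j)))))
  | InteriorMoment j => inr (inr (inr (inr (inr j))))
  end.

Definition dof_decode a b c
    (z : 'I_3 + ('I_3 + ('I_3 + ('I_3 * 'I_a + ('I_3 * 'I_b + 'I_c))))) :
    dof_index a b c :=
  match z with
  | inl i => VertexValue _ _ _ i
  | inr (inl i) => VertexD1 _ _ _ i
  | inr (inr (inl i)) => VertexD2 _ _ _ i
  | inr (inr (inr (inl (i, j)))) => EdgeMoment _ _ i j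
  | inr (inr (inr (inr (inl (i, j))))) => EdgeNormalMoment _ _ i j
  | inr (inr (inr (inr (inr j)))) => InteriorMoment _ _ j
  end.

Lemma dof_codeK a b c : cancel (@dof_code a b c) (@dof_decode a b c).
Proof. by case. Qed.
End Counting.

(** * Unisolvence *)

Theorem theorem3p4 (R : realType) (V : 'I_3 -> R * R) (k : nat)
    (hV : nondegenerate_triangle V) (hk : (2 <= k)%N)
    (lamR : 'I_3 -> R * R -> R) (hlamR : forall i, is_refined_hat V i (lamR i))
    (nrm : 'I_3 -> R * R) (hnrm : forall i, is_unit_normal V i (nrm i))
    (a b c : nat)
    (qa : 'I_3 -> 'I_a -> R * R -> R)
    (hqa : forall i, is_basis (edge V i) (polyOn (k%:Z - 2) (edge V i)) (qa i))
    (qb : 'I_3 -> 'I_b -> R * R -> R)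
    (hqb : forall i, is_basis (edge V i) (polyOn (k%:Z - 1) (edge V i)) (qb i))
    (qc : 'I_c -> R * R -> R)
    (hqc : is_basis (hull V) (polyOn (k%:Z - 4) (hull V)) qc) :
  directOn (hull V) (polyOn (k%:Z + 2) (hull V))
           (spanOn (hull V) (enrichment V k lamR)) /\
  unisolvent (hull V) (U_space V k lamR) (dof V nrm qa qb qc).
Proof.
pose g (z : monomialT k.+3 + 'I_3) : R * R -> R :=
  match z with inl z => monomial z | inr i => enrichment V k lamR i end.
pose P (z : monomialT k.+3 + 'I_3) : 'I_3 -> R * R -> R :=
  match z with inl z => fun=> monomial z | inr i => enrichment_piece V k i end.
have tg z : traces V k.+3 (g z) (P z).
  case: z => [z|i] /=; first exact: (traces_polyfun V (monomial_polyfun _ z)).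
  exact: enrichment_traces.
have sg z : admissible V k.+3 (g z).
  case: z => [z|i] /=; first exact: (admissible_polyfun V (monomial_polyfun _ z)).
  exact: enrichment_admissible.
have dofE J u := dof_comb hV nrm (fun i => (hqa i).1) (fun i => (hqb i).1) hqc.1
  (index_enum (monomialT k.+3 + 'I_3)%type) u J sg.
have free u : (forall J, \sum_z u z * dof V nrm qa qb qc J (g z) = 0) ->
    forall z, u z = 0.
  move=> u0.
  pose v x := \sum_z u z * g z x.
  pose p x := \sum_z u (inl z) * monomial z x.
  have v0 J : dof V nrm qa qb qc J v = 0 by rewrite /v dofE u0.
  have tv : traces V k.+3 v (fun i x => \sum_z u z * P z i x).
    exact: (traces_sum (index_enum (monomialT k.+3 + 'I_3)%type)
      (fun z => tracesZ (u z) (tg z))).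
  have flat := dof_eq0_edge hV hk hnrm hqa hqb tv v0.
  have PE i x : \sum_z u z * P z i x = p x + \sum_j u (inr j) * enrichment_piece V k j i x.
    by rewrite big_sumType.
  have pA i : exists A, polyfun k.+1 A /\
      forall x, \sum_z u z * P z i x = bary V i x ^+ 2 * A x.
    have [||A pA AE] := polyfun_div_bary2 hV (i := i) (tv.1 i); last by exists A.
    - by move=> t; have [] := flat i t.
    - by move=> t; have [] := flat i t.
  have [A AE] := choice pA.
  have ur i : u (inr i) = 0.
    apply: (enrichment_coef_eq0 hV hk (n := k.+1) (p := p)
      (cf := fun i => u (inr i)) (A := A)) => [l|l x]; first exact: (AE l).1.
    by rewrite -PE (AE l).2.
  have Pp i : (fun x => \sum_z u z * P z i x) = p.
    apply/funext => x; rewrite PE big1 ?addr0 // => j _.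
    by rewrite ur mul0r.
  have vp : v = p.
    apply/funext => x; rewrite /v big_sumType /= [X in _ + X]big1 ?addr0 // => j _.
    by rewrite ur mul0r.
  have p0 : forall x, p x = 0.
    apply: (dof_eq0_interior hV hk hqc) => [|i t|j].
    - by rewrite -(Pp 0); exact: tv.1.
    - by rewrite -(Pp i); exact: flat.
    - by rewrite -vp; exact: (v0 (InteriorMoment _ _ j)).
  by case=> [z|i]; [exact: (monomial_free p0)|exact: ur].
have span_p f : polyOn (k%:Z + 2) (hull V) f -> exists u : monomialT k.+3 -> R,
    forall x, hull V x -> f x = \sum_z u z * monomial z x.
  case/(@polyOn_polyfun _ _ k.+3) => [d dk|q /monomial_span[u qE] fq]; first by lia.
  by exists u => x Tx; rewrite fq.
have sumE (u1 : monomialT k.+3 -> R) (u2 : 'I_3 -> R) x :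
    \sum_z (match z with inl z => u1 z | inr i => u2 i end) * g z x =
    \sum_z u1 z * monomial z x + \sum_i u2 i * enrichment V k lamR i x.
  by rewrite big_sumType.
split.
  move=> f h /span_p[u1 fE] [u2 hE] fh0.
  pose u (z : monomialT k.+3 + 'I_3) := match z with inl z => u1 z | inr i => u2 i end.
  have u0 : forall z, u z = 0.
    apply: free => J; rewrite -dofE.
    transitivity (dof V nrm qa qb qc J (fun x => \sum_z (fun=> 0) z * g z x)).
      apply: eq_dof => // x Tx; rewrite sumE -fE // -hE // fh0 // big1 // => z _.
      by rewrite mul0r.
    by rewrite dofE big1 // => z _; rewrite mul0r.
  move=> x Tx; rewrite fE // hE //; split; apply: big1 => z _.
    by rewrite -[u1 z]/(u (inl z)) u0 mul0r.
  by rewrite -[u2 z]/(u (inr z)) u0 mul0r.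
have span_U v : U_space V k lamR v -> exists u : monomialT k.+3 + 'I_3 -> R,
    forall x, hull V x -> v x = \sum_z u z * g z x.
  move=> [f [h [/span_p[u1 fE] [u2 hE] vE]]].
  exists (fun z => match z with inl z => u1 z | inr i => u2 i end) => x Tx.
  by rewrite sumE vE // fE // hE.
pose K := ('I_3 + ('I_3 + ('I_3 + ('I_3 * 'I_a + ('I_3 * 'I_b + 'I_c)))))%type.
pose M z (y : K) := dof V nrm qa qb qc (dof_decode y) (g z).
have Minj u : (forall y, \sum_z u z * M z y = 0) -> forall z, u z = 0.
  by move=> uM; apply: free => J; rewrite -(dof_codeK J); exact: uM.
have card_le : (#|{: K}| <= #|{: monomialT k.+3 + 'I_3}|)%N.
  have -> : #|{: K}| = (3 + (3 + (3 + (3 * a + (3 * b + c)))))%N.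
    by rewrite !card_sum !card_prod !card_ord.
  have -> : #|{: monomialT k.+3 + 'I_3}| = (#|monomialT k.+3| + 3)%N.
    by rewrite card_sum card_ord.
  apply: dimension_count => //.
  - by apply: (edge_basis_le hV _ (hqa 0)) => d; lia.
  - by apply: (edge_basis_le hV _ (hqb 0)) => d; lia.
  - by apply: (hull_basis_le _ hqc) => d; lia.
move=> d; split.
  have [u uE] := (injective_card Minj).2 card_le (fun y => d (dof_decode y)).
  exists (fun x => \sum_z u z * g z x); split; last first.
    by move=> J; rewrite dofE -[in RHS](dof_codeK J) -uE /M dof_codeK.
  exists (fun x => \sum_z u (inl z) * monomial z x).
  exists (fun x => \sum_i u (inr i) * enrichment V k lamR i x); split.
  - apply: (polyfun_polyOn (n := k.+3)) => [m mk|]; first by lia.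
    by apply: polyfun_sum => z _; apply: polyfunZ; exact: monomial_polyfun.
  - by exists (fun i => u (inr i)).
  - by move=> x _; rewrite big_sumType.
move=> v w /span_U[u1 vE] /span_U[u2 wE] vd wd.
have u12 : forall z, u1 z - u2 z = 0.
  apply: free => J.
  rewrite (eq_bigr (fun z => u1 z * dof V nrm qa qb qc J (g z)
                             - u2 z * dof V nrm qa qb qc J (g z))) => [|z _].
    rewrite sumrB -!dofE -(eq_dof hV _ _ _ _ _ vE) -(eq_dof hV _ _ _ _ _ wE).
    by rewrite vd wd subrr.
  by rewrite mulrBl.
move=> x Tx; rewrite vE // wE //; apply: eq_bigr => z _.
by move/eqP: (u12 z); rewrite subr_eq0 => /eqP ->.
Qed.
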